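(* Let $K\subset\mathbb{E}^3$ be a compact convex set whose support function is of class $C^2$ on $S^2$, and let $\mathcal{W}$ be its mean width (which equals its width when $K$ has constant width). (1) If $K$ has constant width $\mathcal{W}$ and $f:[-1,1]\to\mathbb{R}$ is an even bounded measurable function, then $$\int_{E_i\cap K\neq\emptyset}f(\langle u_1,u_2\rangle)\,dE_1\,dE_2=\lambda_0\,\pi\,\mathcal{W}^2,\qquad \lambda_0=2\pi\int_{-1}^1 f(t)\,dt. \qquad ( * )$$ (2) Conversely, if the equality $( * )$ holds for $f=P_{2n}$ for every integer $n\ge 1$, where $P_{2n}$ is the Legendre polynomial of degree $2n$, then $K$ is of constant width.
   Context: The support function of a compact convex set $K\subset\mathbb{E}^3$ is $p(u)=\sup\{\langle x,u\rangle: x\in K\}$, $u\in S^2$. The width of $K$ in direction $u$ is $w(u)=p(u)+p(-u)$; $K$ has constant width if $w$ is constant. The mean width is $\mathcal{W}=\frac1{4\pi}\int_{S^2}w(u)\,du$, with $du$ the surface measure on $S^2$. $dE$ is the isometry-invariant measure on the space $\mathcal{A}_{3,2}$ of affine planes normalized by $\int g(E)\,dE=\int_{\mathrm{Gr}(3,2)}\big(\int_{E_0^\perp}g(E_0+p)\,dp\big)d\nu(E_0)$, where $dp$ is Lebesgue measure on the line $E_0^\perp$ and $\nu$ is the rotation-invariant measure on the Grassmannian $\mathrm{Gr}(3,2)$ of planes through the origin with total mass $2\pi$. The symbol $\int_{E_i\cap K\ne\emptyset}$ means integration over all ordered pairs of planes $(E_1,E_2)$ with $E_1\cap K\neq\emptyset$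 and $E_2\cap K\ne\emptyset$; $u_i$ is a unit normal vector to $E_i$ (the choice of sign is irrelevant since $f$ is even). *)

(* Defs.v *)
From HB Require Import structures.
From mathcomp Require Import all_boot all_order all_algebra.
From mathcomp Require Import all_classical all_reals all_analysis.
From mathcomp Require Import measurable_realfun.

Set Implicit Arguments.
Unset Strict Implicit.
Unset Printing Implicit Defensive.

Import Order.TTheory GRing.Theory Num.Theory.
Import numFieldNormedType.Exports.

Local Open Scope classical_set_scope.
Local Open Scope ring_scope.

Section Euclidean.
Variable R : realType.
Notation E3 := 'rV[R]_3.

(* The norm carried by ['rV[R]_3] in the library is the sup norm, so Euclidean
   notions go through [dot]; the topology is the same. *)
Definition dot (u v : E3) : R := \sum_(i < 3) u ord0 i * v ord0 i.

Definition sphere2 : set E3 := [set u | dot u u = 1].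

Definition hplane (u : E3) (t : R) : set E3 := [set x | dot u x = t].

Definition vec3 (a b c : R) : E3 := \row_(i < 3) [:: a; b; c]`_i.

End Euclidean.

Notation borel3 R := (g_sigma_algebraType (@open 'rV[R]_3)).

Section Bodies.
Variable R : realType.
Notation E3 := 'rV[R]_3.

Definition support_function (K : set E3) (u : E3) : R := sup [set dot x u | x in K].

Definition width (K : set E3) (u : E3) : R :=
  support_function K u + support_function K (- u).

Definition constant_width (K : set E3) : Prop :=
  exists w : R, forall u, sphere2 u -> width K u = w.

Definition sphere_point (theta phi : R) : E3 :=
  vec3 (sin theta * cos phi) (sin theta * sin phi) (cos theta).

(* Integral against the surface measure: the area element is
   sin(theta) dtheta dphi, theta being the colatitude. *)
Definition sphere_integral (g : E3 -> R) : R :=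
  \int[lebesgue_measure]_(phi in `[0%R, (2 * pi)%R])
    \int[lebesgue_measure]_(theta in `[0%R, pi])
      (g (sphere_point theta phi) * sin theta).

Definition mean_width (K : set E3) : R :=
  (4 * pi)^-1 * sphere_integral (width K).

Definition C1_on (U : set E3) (F : E3 -> R) : Prop :=
  forall i : 'I_3,
    (forall x, U x -> derivable F x (delta_mx ord0 i)) /\
    (forall x, U x -> {for x, continuous (fun y => 'D_(delta_mx ord0 i) F y)}).

Definition C2_on (U : set E3) (F : E3 -> R) : Prop :=
  C1_on U F /\ forall i : 'I_3, C1_on U (fun y => 'D_(delta_mx ord0 i) F y).

(* Regularity on the submanifold S^2 : being locally the restriction of a C^2
   function defined on an open subset of the ambient space. *)
Definition C2_on_sphere (p : E3 -> R) : Prop :=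
  forall u0, sphere2 u0 -> exists (U : set E3) (F : E3 -> R),
    [/\ open U, U u0, C2_on U F & forall u, U u -> sphere2 u -> F u = p u].

(* Rodrigues' formula *)
Definition legendre (n : nat) : {poly R} :=
  ((2 ^ n * n`!)%:R)^-1 *: (('X^2 - 1) ^+ n)^`(n).

End Bodies.

Section Euclidean_facts.
Variable R : realType.
Notation E3 := 'rV[R]_3.
Implicit Types (u v w x y : E3).

Lemma dotE u v :
  dot u v = u ord0 (inord 0) * v ord0 (inord 0)
    + u ord0 (inord 1) * v ord0 (inord 1) + u ord0 (inord 2) * v ord0 (inord 2).
Proof.
rewrite /dot !big_ord_recl big_ord0 addr0 addrA.
by congr (_ * _ + _ * _ + _ * _); congr (_ _ _); apply: val_inj; rewrite /= inordK.
Qed.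

Lemma dotC u v : dot u v = dot v u.
Proof. by apply: eq_bigr => i _; rewrite mulrC. Qed.

Lemma dotDl u v w : dot (u + v) w = dot u w + dot v w.
Proof. by rewrite /dot -big_split; apply: eq_bigr => i _; rewrite !mxE mulrDl. Qed.

Lemma dotZl a u v : dot (a *: u) v = a * dot u v.
Proof. by rewrite /dot mulr_sumr; apply: eq_bigr => i _; rewrite !mxE mulrA. Qed.

Lemma dotNl u v : dot (- u) v = - dot u v.
Proof. by rewrite -scaleN1r dotZl mulN1r. Qed.

Lemma dotDr u v w : dot w (u + v) = dot w u + dot w v.
Proof. by rewrite dotC dotDl !(dotC w). Qed.

Lemma dotZr a u v : dot v (a *: u) = a * dot v u.
Proof. by rewrite dotC dotZl (dotC v). Qed.

Lemma dotNr u v : dot v (- u) = - dot v u.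
Proof. by rewrite dotC dotNl (dotC v). Qed.

Lemma dot_ge0 u : 0 <= dot u u.
Proof. by apply: sumr_ge0 => i _; rewrite -expr2 sqr_ge0. Qed.

Lemma dot_eq0 u : dot u u = 0 -> u = 0.
Proof.
move=> /eqP; rewrite psumr_eq0; last by move=> i _; rewrite -expr2 sqr_ge0.
move=> /allP h; apply/rowP => i; rewrite mxE.
have := h i; rewrite mem_index_enum => /(_ isT).
by rewrite -expr2 sqrf_eq0 => /eqP.
Qed.

Lemma hplaneN u t : hplane (- u) (- t) = hplane u t.
Proof.
by apply/seteqP; split=> x; rewrite /hplane /= dotNl; [move/oppr_inj|move->].
Qed.

Lemma sphere2N u : sphere2 (- u) = sphere2 u.
Proof. by rewrite /sphere2 /= dotNl dotNr opprK. Qed.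

Definition unit_normal (u : E3) (E : set E3) : Prop :=
  sphere2 u /\ forall x y, E x -> E y -> dot u (x - y) = 0.

Lemma hplane_unit_normal u t : sphere2 u -> unit_normal u (hplane u t).
Proof.
by move=> uS; split=> // x y; rewrite /hplane /= dotDr dotNr => -> ->; rewrite subrr.
Qed.

Lemma unit_normal_hplane u v t :
  sphere2 u -> unit_normal v (hplane u t) -> v = u \/ v = - u.
Proof.
rewrite /sphere2 /= => uS [vS vE].
pose c := dot v u; pose w := v - c *: u.
have uw : dot u w = 0 by rewrite dotDr dotNr dotZr uS mulr1 /c (dotC u) subrr.
have vw : dot v w = 0.
  have -> : w = (t *: u + w) - t *: u by rewrite addrAC subrr add0r.
  apply: vE; rewrite /hplane /=; last by rewrite dotZr uS mulr1.
  by rewrite (dotDr (t *: u) w u) dotZr uS mulr1 uw addr0.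
have cc : c * c = 1.
  by move: vw; rewrite dotDr dotNr dotZr vS -/c => /subr0_eq.
have w0 : v = c *: u.
  apply: subr0_eq; apply: dot_eq0; rewrite -/w {1}/w dotDl dotNl dotZl.
  by rewrite vw uw mulr0 subr0.
have /eqP : c ^+ 2 == 1 by rewrite expr2 cc.
move/eqP; rewrite sqrf_eq1 => /orP[]/eqP ce; rewrite w0 ce.
  by left; rewrite scale1r.
by right; rewrite scaleN1r.
Qed.

(* Selects one vector out of each pair {u, -u} with u != 0. *)
Definition lexpos (u : E3) : bool :=
  let c k := u ord0 (inord k) in
  [|| 0 < c 0%N, (c 0%N == 0) && (0 < c 1%N)
    | [&& c 0%N == 0, c 1%N == 0 & 0 < c 2%N]].

Lemma lexposN u : sphere2 u -> lexpos (- u) = ~~ lexpos u.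
Proof.
rewrite /sphere2 /lexpos /= dotE !mxE !oppr_gt0 !oppr_eq0.
set a := u _ _; set b := u _ _; set c := u _ _ => h.
case: (ltgtP a 0) => //= a0; case: (ltgtP b 0) => //= b0.
case: (ltgtP c 0) => //= c0.
by move: h; rewrite a0 b0 c0 !mulr0 !addr0 => /esym/eqP; rewrite oner_eq0.
Qed.

(* The sign is fixed by [lexpos], which makes the choice measurable on planes,
   see [measurable_normal]. *)
Definition plane_normal (E : set E3) : E3 :=
  xget 0 [set u | unit_normal u E /\ lexpos u].

Lemma normal_hplane u t : sphere2 u ->
  plane_normal (hplane u t) = if lexpos u then u else - u.
Proof.
move=> uS; rewrite /plane_normal; case: ifPn => up.
  apply: xget_subset1.
    by split=> //; exact: hplane_unit_normal.
  move=> v w [/(unit_normal_hplane uS)[]-> vp] [/(unit_normal_hplane uS)[]-> wp] //.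
    by move: wp; rewrite lexposN// up.
  by move: vp; rewrite lexposN// up.
have uNp : lexpos (- u) by rewrite lexposN.
apply: xget_subset1.
  split=> //; rewrite -hplaneN; apply: hplane_unit_normal.
  by rewrite sphere2N.
move=> v w [/(unit_normal_hplane uS)[]-> vp] [/(unit_normal_hplane uS)[]-> wp] //.
  by move: vp; rewrite (negbTE up).
by move: wp; rewrite (negbTE up).
Qed.

Lemma hplane_offset u v s t : sphere2 u -> sphere2 v ->
  hplane u s = hplane v t -> `|s| = `|t|.
Proof.
move=> uS vS e.
have := hplane_unit_normal t vS; rewrite -e => /(unit_normal_hplane uS)[]vE.
  have : hplane v t (s *: u) by rewrite -e /hplane /= dotZr uS mulr1.
  by rewrite vE /hplane /= dotZr uS mulr1 => ->.
have : hplane v t (s *: u) by rewrite -e /hplane /= dotZr uS mulr1.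
by rewrite vE /hplane /= dotZr dotNl uS mulrN1 => <-; rewrite normrN.
Qed.

Lemma dotvv_continuous : continuous (fun x : E3 => dot x x).
Proof.
apply: (@continuous_big R _ +%R 0 xpredT) => [z|i _ x].
  exact: (@add_continuous R^o).
have c := @coord_continuous R 1 3 ord0 i x.
exact: (@cvgM R E3 (nbhs x) _ _ _ _ _ c c).
Qed.

Lemma borel3_continuous_measurable (f : borel3 R -> R) :
  continuous (f : E3 -> R) -> measurable_fun setT f.
Proof.
move=> cf; apply: (@measurability _ _ _ _ _ _ _ (RGenOpens.measurableE R)) => //.
move=> _ [_ [a [b ->] <-]]; rewrite setTI.
apply: sub_sigma_algebra; apply: open_comp; last exact: interval_open.
by move=> ? _; exact: cf.
Qed.

Lemma borel3_opp_measurable : measurable_fun setT (-%R : borel3 R -> borel3 R).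
Proof.
apply: (@measurability _ _ (borel3 R) (borel3 R) setT _ (@open E3)) => [//|].
move=> _ [B oB <-]; rewrite setTI; apply: sub_sigma_algebra.
by apply: open_comp => // x _; exact: opp_continuous.
Qed.

Lemma measurable_sphere2 : measurable (@sphere2 R : set (borel3 R)).
Proof.
rewrite (_ : @sphere2 R = (fun x : borel3 R => dot x x) @^-1` [set 1])//.
rewrite -[X in measurable X]setTI.
by apply: borel3_continuous_measurable => //; exact: dotvv_continuous.
Qed.

Lemma measurable_lexpos : measurable ([set u | lexpos u] : set (borel3 R)).
Proof.
have mc k : measurable_fun setT (fun u : borel3 R => (u : E3) ord0 (inord k)).
  by apply: borel3_continuous_measurable; exact: coord_continuous.
have mp k : measurable ([set u | 0 < (u : E3) ord0 (inord k)] : set (borel3 R)).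
  rewrite (_ : mkset _ =
    setT `&` (fun u : borel3 R => (u : E3) ord0 (inord k)) @^-1` `]0, +oo[).
    by apply: mc.
  by rewrite setTI; apply/seteqP; split=> u /=; rewrite in_itv/= andbT.
have mz k : measurable ([set u | (u : E3) ord0 (inord k) = 0] : set (borel3 R)).
  rewrite (_ : mkset _ =
    setT `&` (fun u : borel3 R => (u : E3) ord0 (inord k)) @^-1` [set 0]).
    by apply: mc.
  by rewrite setTI.
rewrite (_ : mkset _ = [set u : borel3 R | 0 < (u : E3) ord0 (inord 0)] `|`
   ([set u : borel3 R | (u : E3) ord0 (inord 0) = 0] `&`
    [set u : borel3 R | 0 < (u : E3) ord0 (inord 1)]) `|`
   ([set u : borel3 R | (u : E3) ord0 (inord 0) = 0] `&`
    [set u : borel3 R | (u : E3) ord0 (inord 1) = 0] `&`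
    [set u : borel3 R | 0 < (u : E3) ord0 (inord 2)])).
  apply: measurableU; first by apply: measurableU => //; apply: measurableI.
  by apply: measurableI => //; apply: measurableI.
apply/seteqP; split=> u /=.
  move=> /or3P[h|/andP[/eqP h1 h2]|/and3P[/eqP h1 /eqP h2 h3]].
  - by left; left.
  - by left; right.
  - by right.
move=> [[h|[h1 h2]]|[[h1 h2] h3]]; apply/or3P.
- exact: Or31.
- by apply: Or32; apply/andP; split=> //; apply/eqP.
- by apply: Or33; apply/and3P; split=> //; apply/eqP.
Qed.

End Euclidean_facts.

Section Planes.
Variable R : realType.
Notation E3 := 'rV[R]_3.

Definition is_plane (E : set E3) : Prop :=
  exists u t, sphere2 u /\ E = hplane u t.

Record affplane := AffPlane {
  aff_set :> set E3 ;
  aff_setP : is_plane aff_set }.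

Record grplane := GrPlane {
  gr_plane :> affplane ;
  gr_plane0 : aff_set gr_plane 0 }.

Lemma aff_set_inj : injective aff_set.
Proof.
by move=> [A pA] [B pB] /= AB; subst B; congr AffPlane; exact: Prop_irrelevance.
Qed.

Lemma gr_set_inj (P Q : grplane) : (P : set E3) = Q -> P = Q.
Proof.
move: P Q => [A pA] [B pB] /= /aff_set_inj AB; subst B.
by congr GrPlane; exact: Prop_irrelevance.
Qed.

Lemma sphere2_e0 : sphere2 (delta_mx ord0 ord0 : E3).
Proof.
rewrite /sphere2 /= /dot big_ord_recl big1 ?addr0 => [|i _].
  by rewrite mxE /= mulr1.
by rewrite mxE /= mul0r.
Qed.

Definition aff_hplane u t (uS : sphere2 u) : affplane :=
  @AffPlane (hplane u t) (ex_intro _ u (ex_intro _ t (conj uS erefl))).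

Lemma hplane0 u : hplane u 0 (0 : E3).
Proof. by rewrite /hplane /= -(scale0r 0) dotZr mul0r. Qed.

Definition gr_hplane u (uS : sphere2 u) : grplane :=
  @GrPlane (aff_hplane 0 uS) (hplane0 u).

Lemma grplaneP (P : grplane) : exists2 u, sphere2 u & (P : set E3) = hplane u 0.
Proof.
have [u [t [uS Pu]]] := aff_setP P; exists u => //; rewrite Pu; congr hplane.
by have := gr_plane0 P; rewrite Pu => <-; exact: hplane0.
Qed.

HB.instance Definition _ := gen_eqMixin affplane.
HB.instance Definition _ := gen_choiceMixin affplane.
HB.instance Definition _ := isPointed.Build affplane (aff_hplane 0 sphere2_e0).
HB.instance Definition _ := gen_eqMixin grplane.
HB.instance Definition _ := gen_choiceMixin grplane.
HB.instance Definition _ := isPointed.Build grplane (gr_hplane sphere2_e0).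

(* Borel sigma-algebras of both spaces, as quotients of S^2 and of S^2 x R by
   u ~ -u and (u, t) ~ (-u, -t). *)
Definition gr_preimage (B : set grplane) : set (borel3 R) :=
  [set u | sphere2 u /\ exists2 P : grplane, B P & (P : set E3) = hplane u 0].

Definition gr_measurable : set (set grplane) :=
  [set B | measurable (gr_preimage B)].

Definition aff_preimage (B : set affplane) : set (borel3 R * R) :=
  [set ut | sphere2 ut.1 /\
    exists2 E : affplane, B E & (E : set E3) = hplane ut.1 ut.2].

Definition aff_measurable : set (set affplane) :=
  [set B | measurable (aff_preimage B)].

Lemma gr_measurable0 : gr_measurable set0.
Proof.
rewrite /gr_measurable /= (_ : gr_preimage _ = set0)//.
by apply/seteqP; split=> // u [_ []].
Qed.

Lemma gr_measurableC B : gr_measurable B -> gr_measurable (~` B).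
Proof.
rewrite /gr_measurable /= => mB.
rewrite (_ : gr_preimage _ = @sphere2 R `\` gr_preimage B).
  by apply: measurableD => //; exact: measurable_sphere2.
apply/seteqP; split=> u /= [uS].
  move=> [P BP Pu]; split=> // -[_ [Q BQ Qu]]; apply: BP.
  by rewrite (_ : P = Q)//; apply: gr_set_inj; rewrite Pu.
move=> nB; split=> //; exists (gr_hplane uS) => //= BP.
by apply: nB; split=> //; exists (gr_hplane uS).
Qed.

Lemma gr_measurable_bigcup (F : (set grplane)^nat) :
  (forall i, gr_measurable (F i)) -> gr_measurable (\bigcup_i F i).
Proof.
rewrite /gr_measurable /= => mF.
rewrite (_ : gr_preimage _ = \bigcup_i gr_preimage (F i)).
  exact: bigcup_measurable.
apply/seteqP; split=> [u [uS [P [i _ FP] Pu]]|u [i _ [uS [P FP Pu]]]].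
  by exists i => //; split=> //; exists P.
by split=> //; exists P => //; exists i.
Qed.

Lemma aff_measurable0 : aff_measurable set0.
Proof.
rewrite /aff_measurable /= (_ : aff_preimage _ = set0)//.
by apply/seteqP; split=> // u [_ []].
Qed.

Lemma measurable_sphere2R :
  measurable ([set ut | sphere2 ut.1] : set (borel3 R * R)).
Proof.
rewrite (_ : mkset _ = (@sphere2 R : set (borel3 R)) `*` setT).
  by apply: measurableX => //; exact: measurable_sphere2.
by apply/seteqP; split=> [ut|ut []]; rewrite /= //; split.
Qed.

Lemma aff_measurableC B : aff_measurable B -> aff_measurable (~` B).
Proof.
rewrite /aff_measurable /= => mB.
rewrite (_ : aff_preimage _ = [set ut | sphere2 ut.1] `\` aff_preimage B).
  by apply: measurableD => //; exact: measurable_sphere2R.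
apply/seteqP; split=> -[u t] /= [uS].
  move=> [P BP Pu]; split=> // -[_ [Q BQ Qu]]; apply: BP.
  by rewrite (_ : P = Q)//; apply: aff_set_inj; rewrite Pu.
move=> nB; split=> //; exists (aff_hplane t uS) => //= BP.
by apply: nB; split=> //; exists (aff_hplane t uS).
Qed.

Lemma aff_measurable_bigcup (F : (set affplane)^nat) :
  (forall i, aff_measurable (F i)) -> aff_measurable (\bigcup_i F i).
Proof.
rewrite /aff_measurable /= => mF.
rewrite (_ : aff_preimage _ = \bigcup_i aff_preimage (F i)).
  exact: bigcup_measurable.
apply/seteqP; split=> [u [uS [P [i _ FP] Pu]]|u [i _ [uS [P FP Pu]]]].
  by exists i => //; split=> //; exists P.
by split=> //; exists P => //; exists i.
Qed.

HB.instance Definition _ := @isMeasurable.Build default_measure_display grplane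
  gr_measurable gr_measurable0 gr_measurableC gr_measurable_bigcup.

HB.instance Definition _ := @isMeasurable.Build default_measure_display affplane
  aff_measurable aff_measurable0 aff_measurableC aff_measurable_bigcup.

(* Direct images of measurable sets are measurable here, rotations being
   bijective on the Grassmannian. *)
Definition rotation_invariant (nu : set grplane -> \bar R) : Prop :=
  forall Q : 'M[R]_3, Q *m Q^T = 1%:M -> \det Q = 1 ->
  forall B : set grplane, measurable B ->
  nu [set P : grplane | exists2 P0 : grplane, B P0 &
        (P : set E3) = [set x *m Q | x in (P0 : set E3)]] = nu B.

Lemma gr_translate_plane (P : grplane) (p : E3) :
  is_plane [set x + p | x in (P : set E3)].
Proof.
have [u uS Pu] := grplaneP P; exists u, (dot u p); split=> //.
apply/seteqP; split=> [_ [x + <-]|x xp]; rewrite /hplane /=.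
  by rewrite Pu /hplane /= dotDr => ->; rewrite add0r.
exists (x - p); last by rewrite subrK.
by rewrite Pu /hplane /= dotDr dotNr (xp : _ = _) subrr.
Qed.

Definition gr_translate (P : grplane) (p : E3) : affplane :=
  AffPlane (gr_translate_plane P p).

Lemma normal_grplane (P : grplane) :
  sphere2 (plane_normal P) /\ (P : set E3) = hplane (plane_normal P) 0.
Proof.
have [u uS Pu] := grplaneP P; rewrite Pu normal_hplane//.
case: ifP => _; split=> //; first by rewrite sphere2N.
by rewrite -[in RHS]oppr0 hplaneN.
Qed.

Lemma gr_translate_normal (P : grplane) (s : R) :
  (gr_translate P (s *: plane_normal P) : set E3) = hplane (plane_normal P) s.
Proof.
have [nS Pn] := normal_grplane P; set n := plane_normal P in nS Pn *.
rewrite /= Pn; apply/seteqP; split=> [_ [x + <-]|x xp]; rewrite /hplane /=.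
  by rewrite dotDr => ->; rewrite add0r dotZr nS mulr1.
exists (x - s *: n); last by rewrite subrK.
by rewrite dotDr dotNr dotZr nS mulr1 (xp : _ = _) subrr.
Qed.

Lemma measurable_normal :
  measurable_fun setT (fun P : grplane => plane_normal P : borel3 R).
Proof.
move=> _ A mA; rewrite setTI /measurable /= /gr_measurable /=.
rewrite (_ : gr_preimage _ = @sphere2 R `&`
  ((A `&` [set u | lexpos u]) `|` ((-%R @^-1` A) `\` [set u | lexpos u]))).
  apply: measurableI; first exact: measurable_sphere2.
  apply: measurableU.
    by apply: measurableI => //; exact: measurable_lexpos.
  apply: measurableD; last exact: measurable_lexpos.
  by rewrite -[X in measurable X]setTI; exact: borel3_opp_measurable.
apply/seteqP; split=> u /= [uS].
  move=> [P AP Pu]; split=> //; move: AP; rewrite /= Pu normal_hplane//.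
  by case: ifPn => up ?; [left|right; split=> //; apply/negP].
move=> h; split=> //; exists (gr_hplane uS) => //=.
by rewrite normal_hplane//; case: ifPn h => up [[]|[]].
Qed.

End Planes.

Section PlaneMeasure.
Variable R : realType.
Notation E3 := 'rV[R]_3.
Variable nu : {finite_measure set (grplane R) -> \bar R}.

Definition plane_of (Ps : grplane R * R) : affplane R :=
  gr_translate Ps.1 (Ps.2 *: plane_normal Ps.1).

Lemma measurable_plane_of : measurable_fun setT plane_of.
Proof.
move=> _ B mB; rewrite setTI.
rewrite (_ : plane_of @^-1` B =
  setT `&` (fun Ps : grplane R * R => (plane_normal Ps.1 : borel3 R, Ps.2))
     @^-1` aff_preimage B).
  have mf : measurable_fun setT
      (fun Ps : grplane R * R => (plane_normal Ps.1 : borel3 R, Ps.2)).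
    apply/measurable_fun_pair => //=.
    exact: (measurableT_comp (@measurable_normal R)).
  exact: mf.
rewrite setTI; apply/seteqP; split=> -[P s] /=.
  move=> BP; split; first by case: (normal_grplane P).
  by exists (plane_of (P, s)) => //; exact: gr_translate_normal.
move=> [_ [E BE En]].
by rewrite (_ : plane_of _ = E)//; apply: aff_set_inj; rewrite gr_translate_normal.
Qed.

(* The measure dE. Every line [E_0^\perp] is identified with [R] by the
   isometry [s |-> s *: plane_normal E_0]; see [plane_measure_integral]. *)
Definition plane_measure : set (affplane R) -> \bar R :=
  pushforward (nu \x lebesgue_measure)%E plane_of.

Let mu0 : plane_measure set0 = 0%E.
Proof. by rewrite /plane_measure /pushforward preimage_set0 measure0. Qed.

Let mu_ge0 A : (0 <= plane_measure A)%E.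
Proof. by rewrite /plane_measure /pushforward; exact: measure_ge0. Qed.

Let mu_sigma_additive : semi_sigma_additive plane_measure.
Proof.
move=> F mF tF mUF; rewrite /plane_measure /pushforward preimage_bigcup.
apply: measure_semi_sigma_additive.
- by move=> n; rewrite -[X in measurable X]setTI; exact: measurable_plane_of.
- apply/trivIsetP => /= i j _ _ ij; rewrite -preimage_setI.
  by move/trivIsetP : tF => /(_ _ _ _ _ ij) ->//; rewrite preimage_set0.
- by rewrite -preimage_bigcup -[X in measurable X]setTI; exact: measurable_plane_of.
Qed.

HB.instance Definition _ := isMeasure.Build _ _ _ plane_measure
  mu0 mu_ge0 mu_sigma_additive.

Let near_origin (k : nat) : set (affplane R) := [set E : affplane R |
  exists u t, [/\ sphere2 u, `|t| <= k%:R & (E : set E3) = hplane u t]].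

Let measurable_near_origin k : measurable (near_origin k).
Proof.
rewrite /measurable /= /aff_measurable /=.
rewrite (_ : aff_preimage _ = (@sphere2 R : set (borel3 R)) `*` `[- k%:R, k%:R]).
  by apply: measurableX => //; exact: measurable_sphere2.
apply/seteqP; split=> -[u t] /= [uS].
  move=> [E [v [s [vS sk ->]]]] e; split=> //=.
  by rewrite in_itv /= -ler_norml -(hplane_offset vS uS e).
rewrite in_itv /= -ler_norml => tk; split=> //.
by exists (aff_hplane t uS) => //; exists u, t.
Qed.

Let mu_sigma_finite : sigma_finite setT plane_measure.
Proof.
exists near_origin.
  apply/seteqP; split=> // E _; have [u [t [uS Eu]]] := aff_setP E.
  exists (Num.truncn `|t|).+1 => //; exists u, t; split=> //.
  by apply/ltW; exact: truncnS_gt.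
move=> k; split; first exact: measurable_near_origin.
rewrite /plane_measure /pushforward.
rewrite (_ : plane_of @^-1` _ = setT `*` `[- k%:R, k%:R]%classic).
  rewrite [ltLHS]product_measure1E//= lebesgue_measure_itv /=.
  case: ifP => _; last by rewrite mule0.
  by apply: lte_mul_pinfty => //; [exact: fin_num_measure|exact: ltry].
apply/seteqP; split=> -[P s] /=; have [nS _] := normal_grplane P.
  move=> [u [t [uS tk]]]; rewrite gr_translate_normal => e; split=> //.
  by rewrite in_itv /= -ler_norml (hplane_offset nS uS e).
move=> [_]; rewrite in_itv /= -ler_norml => sk.
by exists (plane_normal P), s; split=> //; rewrite gr_translate_normal.
Qed.

HB.instance Definition _ := @isSigmaFinite.Build _ _ _ plane_measure
  mu_sigma_finite.

Lemma plane_measure_integral (g : affplane R -> \bar R) :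
  measurable_fun [set: affplane R] g -> (forall E, (0 <= g E)%E) ->
  (\int[plane_measure]_E g E =
   \int[nu]_P \int[lebesgue_measure]_s g (gr_translate P (s *: plane_normal P)))%E.
Proof.
move=> mg g0; rewrite ge0_integral_pushforward//; last exact: measurable_plane_of.
rewrite preimage_setT fubini_tonelli1//.
  exact: (measurableT_comp mg measurable_plane_of).
by move=> x; exact: g0.
Qed.

Definition hits (K : set E3) : set (affplane R) :=
  [set E : affplane R | (E : set E3) `&` K !=set0].

(* For even [f] the integrand does not depend on the signs of the normals. *)
Definition pair_integral (K : set E3) (f : R -> R) : \bar R :=
  (\int[plane_measure \x plane_measure]_(EE in hits K `*` hits K)
    (f (dot (plane_normal EE.1) (plane_normal EE.2)))%:E)%E.

End PlaneMeasure.

Definition lambda0 (R : realType) (f : R -> R) : R :=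
  2 * pi * \int[lebesgue_measure]_(t in `[(-1)%R, 1%R]) f t.

Definition mean_width_identity (R : realType)
    (nu : {finite_measure set (grplane R) -> \bar R})
    (K : set 'rV[R]_3) (f : R -> R) : Prop :=
  pair_integral nu K f = (lambda0 f * pi * mean_width K ^+ 2)%:E.

(* Main.v *)
(** Planes are integrated through their unit normals n: the hitting condition
contributes the width w(n), and the double integral of f becomes the integral of
f(<n1, n2>) w(n1) w(n2) against nu twice. Surface measure is never needed: by
invariance, the integral of <a, n>^(2k) dnu(n) equals M_k |a|^(2k) for every
vector a, and comparing coefficients for a = e_i + s e_j gives
M_k = 2 pi / (2k + 1), the moments of pi times Lebesgue measure on [-1, 1].

(1) For constant width W, the law of <n1, n2>^2 on the pairs of planes that hit K
has the moments of 2 pi^2 W^2 times the law of t^2 under Lebesgue measure on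
[-1, 1]. Measures on [0, 1] are determined by their moments, because polynomials
in [0, 1] converge to indicators of half-lines.

(2) The identities for the P_2n give the same moments up to a factor: the integral
of <n1, n2>^(2k) w(n1) w(n2) is A^2 / (2k + 1), with A the integral of w. Hence
the integral of <n1, n2>^(2k) (w(n1) - w(n2))^2 is 2 V / (2k + 1), where
V = 2 pi int w^2 - A^2. As w is even and Lipschitz,
(w(n1) - w(n2))^2 <= C (1 - <n1, n2>^2), which bounds V by a multiple of
1 / (2k + 3) for every k. So V = 0, w is almost everywhere equal to its mean, and
concentrating <u, n>^(2k) at n = u, -u shows that w(u) is this mean. *)

Require Import Defs.
From HB Require Import structures.
From mathcomp Require Import all_boot all_order all_algebra.
From mathcomp Require Import all_classical all_reals all_analysis.
From mathcomp Require Import measurable_realfun.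
From mathcomp Require Import zify ring lra.

Set Implicit Arguments.
Unset Strict Implicit.
Unset Printing Implicit Defensive.

Import Order.TTheory GRing.Theory Num.Theory.
Import numFieldNormedType.Exports.
Local Open Scope classical_set_scope.
Local Open Scope ring_scope.

Lemma integrable_bounded d (T : measurableType d) (R : realType)
    (m : {measure set T -> \bar R}) (D : set T) (f : T -> R) (M : R) :
  measurable D -> (m D < +oo)%E -> measurable_fun D f ->
  (forall x, D x -> `|f x| <= M) -> m.-integrable D (EFin \o f).
Proof.
move=> mD mDoo mf fM; apply: measurable_bounded_integrable => //.
exists M; split; first exact: num_real.
by move=> y My x Dx; apply: le_trans (fM x Dx) (ltW My).
Qed.

(** * Determinacy of the moment problem on [0, 1] *)

Section HausdorffMoments.
Variable R : realType.
Notation I01 := (`[0%R, 1%R]%classic : set R).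

Lemma horner_bounded (p : {poly R}) :
  exists M, forall x, `|x| <= 1 -> `|p.[x]| <= M.
Proof.
elim/poly_ind: p => [|p c [M pM]].
  by exists 0 => x _; rewrite horner0 normr0.
exists (M + `|c|) => x x1; rewrite hornerMXaddC.
apply: le_trans (ler_normD _ _) _; rewrite lerD2r normrM.
by apply: le_trans (pM x x1); apply: ler_piMr.
Qed.

Lemma measurable_horner (p : {poly R}) (D : set R) :
  measurable_fun D (horner p).
Proof.
by apply: measurable_funTS; apply: continuous_measurable_fun; exact: continuous_horner.
Qed.

Lemma integrable_horner d (T : measurableType d) (m : {measure set T -> \bar R})
    (D : set T) (X : T -> R) (p : {poly R}) :
  measurable D -> (m D < +oo)%E -> measurable_fun setT X ->
  (forall x, D x -> `|X x| <= 1) ->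
  m.-integrable D (EFin \o (fun x => p.[X x])).
Proof.
move=> mD moo mX X1; have [M pM] := horner_bounded p.
apply: (@integrable_bounded _ _ _ _ _ _ M) => // [|x Dx]; last exact/pM/X1.
apply: measurable_funTS; apply: (measurableT_comp _ mX).
exact: measurable_horner.
Qed.

Lemma integrable_horner01 (m : {measure set R -> \bar R}) (p : {poly R}) :
  (m I01 < +oo)%E -> m.-integrable I01 (EFin \o horner p).
Proof.
move=> moo; apply: (@integrable_horner _ _ _ _ id) => // x.
by rewrite /= in_itv/= => /andP[x0 x1]; rewrite ger0_norm.
Qed.

Lemma eq_moments_horner (m1 m2 : {measure set R -> \bar R}) (p : {poly R}) :
  (m1 I01 < +oo)%E -> (m2 I01 < +oo)%E ->
  (forall k, \int[m1]_(x in I01) (x ^+ k) = \int[m2]_(x in I01) (x ^+ k)) ->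
  \int[m1]_(x in I01) p.[x] = \int[m2]_(x in I01) p.[x].
Proof.
move=> m1oo m2oo m12; rewrite -[p]coefK poly_def.
apply: (big_ind (fun q : {poly R} =>
  \int[m1]_(x in I01) q.[x] = \int[m2]_(x in I01) q.[x])).
- by under eq_Rintegral do rewrite horner0;
    under [RHS]eq_Rintegral do rewrite horner0; rewrite !Rintegral_cst// !mul0r.
- move=> q r qE rE; under eq_Rintegral do rewrite hornerD.
  under [RHS]eq_Rintegral do rewrite hornerD.
  by rewrite !RintegralD ?qE ?rE//; exact: integrable_horner01.
- move=> i _; under eq_Rintegral do rewrite hornerZ.
  under [RHS]eq_Rintegral do rewrite hornerZ.
  rewrite !RintegralZl//; try exact: integrable_horner01.
  congr (_ * _); under eq_Rintegral do rewrite hornerXn.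
  by under [RHS]eq_Rintegral do rewrite hornerXn.
Qed.

(** Dominated convergence with the constant 1 as majorant: on each side the integrals of [p n] tend
    to the mass of A inside D, and equal sequences have equal limits. *)
Lemma eq_measure_poly_limit (m1 m2 : {measure set R -> \bar R})
    (D A : set R) (p : nat -> {poly R}) :
  measurable D -> D `<=` I01 -> measurable A ->
  (m1 D < +oo)%E -> (m2 D < +oo)%E ->
  (forall n x, D x -> `|(p n).[x]| <= 1) ->
  (forall x, D x -> (p n).[x] @[n --> \oo] --> (\1_A x : R)) ->
  (forall n, \int[m1]_(x in D) (p n).[x] = \int[m2]_(x in D) (p n).[x]) ->
  m1 (A `&` D) = m2 (A `&` D).
Proof.
move=> mD DI mA m1oo m2oo pb pA m12.
have ip (m : {measure set R -> \bar R}) n : (m D < +oo)%E ->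
    m.-integrable D (EFin \o horner (p n)).
  by move=> moo; apply: integrable_bounded (pb n) => //; exact: measurable_horner.
have m12E n : (\int[m1]_(x in D) (p n).[x]%:E = \int[m2]_(x in D) (p n).[x]%:E)%E.
  rewrite -[LHS]fineK; last by apply: integrable_fin_num => //; exact: ip.
  rewrite -[RHS]fineK; last by apply: integrable_fin_num => //; exact: ip.
  by congr EFin; exact: m12.
have key (m : {measure set R -> \bar R}) : (m D < +oo)%E ->
    (fun n => \int[m]_(x in D) (p n).[x]%:E)%E @ \oo --> m (A `&` D).
  move=> moo; rewrite -(@integral_indic _ _ _ m D)//.
  have [] := @dominated_convergence _ _ R m D mD (fun n => EFin \o horner (p n))
    (EFin \o \1_A) (cst 1%E).
  - by move=> n; apply/measurable_EFinP; exact: measurable_horner.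
  - by apply/measurable_EFinP; apply: measurable_funTS; exact: measurable_indic.
  - apply: aeW => x Dx; apply: cvg_EFin; last exact: pA.
    by near=> n.
  - by apply: (@integrable_bounded _ _ _ _ _ (cst 1) 1) => // x _; rewrite normr1.
  - by apply: aeW => x n Dx; rewrite /= lee_fin pb.
  by move=> _ _; apply.
have := key m2 m2oo; rewrite -(funext m12E) => k2.
by rewrite -(cvg_lim _ (key m1 m1oo))// -(cvg_lim _ k2).
Unshelve. all: by end_near. Qed.

Lemma bernoulli_le (x : R) n : -1 <= x -> 1 + n%:R * x <= (1 + x) ^+ n.
Proof.
move=> x1; elim: n => [|n IHn]; first by rewrite mul0r addr0 expr0.
rewrite exprS; apply: le_trans (_ : (1 + x) * (1 + n%:R * x) <= _).
  rewrite -natr1; have : 0 <= n%:R * x ^+ 2 by rewrite mulr_ge0// sqr_ge0.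
  by set a := n%:R; nra.
by apply: ler_wpM2l => //; lra.
Qed.

(** For [s] and x in [0, 1] the base lies in [0, 1] and equals 1 only at x = s, so its powers
    isolate the atom at [s]. *)
Definition spike (s : R) (n : nat) : {poly R} := (1 - ('X - s%:P) ^+ 2) ^+ n.

Lemma horner_spike s n x : (spike s n).[x] = (1 - (x - s) ^+ 2) ^+ n.
Proof. by rewrite /spike !hornerE. Qed.

Lemma sqr_dist01 s x : I01 s -> I01 x -> (x - s) ^+ 2 <= 1.
Proof.
rewrite /= !in_itv/= => /andP[s0 s1] /andP[x0 x1].
have /andP[h1 h2] : -1 <= x - s <= 1 by lra.
by rewrite -subr_ge0 (_ : 1 - _ = (1 - (x - s)) * (1 + (x - s))) ?mulr_ge0; [|lra|lra|ring].
Qed.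

Lemma cvg_spike s x : I01 s -> I01 x ->
  (spike s n).[x] @[n --> \oo] --> (\1_[set s] x : R).
Proof.
move=> sI xI; have le1 := sqr_dist01 sI xI.
rewrite (funext (fun n => horner_spike s n x)).
rewrite indicE; have [->|xs] := eqVneq x s.
  rewrite mem_set// subrr expr0n/= subr0; rewrite (funext (fun n => expr1n R n)).
  exact: cvg_cst.
rewrite memNset; last exact/eqP.
apply: cvg_expr; have xs2 : 0 < (x - s) ^+ 2 by rewrite exprn_even_gt0//= subr_eq0.
by rewrite ltr_norml; apply/andP; split; lra.
Qed.

Lemma spike_le1 s n x : I01 s -> I01 x -> `|(spike s n).[x]| <= 1.
Proof.
move=> sI xI; have le1 := sqr_dist01 sI xI; have := sqr_ge0 (x - s).
rewrite horner_spike normrX => ge0; rewrite exprn_ile1//.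
by rewrite ler_norml; apply/andP; split; lra.
Qed.

(* The exponent is [s ^- n] rounded down, so that [N * x ^ n] tends to 0 or to
   infinity according to whether [x < s] or [x > s]. *)
Definition step_poly (s : R) (n : nat) : {poly R} :=
  (1 - 'X^n) ^+ Num.truncn (s^-1 ^+ n).

Lemma horner_step s n x :
  (step_poly s n).[x] = (1 - x ^+ n) ^+ Num.truncn (s^-1 ^+ n).
Proof. by rewrite /step_poly !hornerE. Qed.

Lemma step_ge0_le1 s n x : I01 x -> 0 <= (step_poly s n).[x] <= 1.
Proof.
rewrite /= !in_itv/= => /andP[x0 x1]; rewrite horner_step.
have xn0 : 0 <= x ^+ n by exact: exprn_ge0.
have xn1 : x ^+ n <= 1 by exact: exprn_ile1.
by rewrite exprn_ge0/= ?subr_ge0// exprn_ile1//; lra.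
Qed.

(** Let N be the exponent in [step_poly]. For x < s, Bernoulli gives (1 - x^n)^N >= 1 - N x^n >= 1 -
    (x/s)^n. For x > s, the product of (1 - x^n)^N and (1 + x^n)^N is at most 1, while the second
    factor is at least (x/s)^n. The point x = s is excluded because for s < 1 the limit there is
    exp(-1). *)
Lemma cvg_step s x : 0 < s -> I01 x -> x != s ->
  (step_poly s n).[x] @[n --> \oo] --> (\1_(`]-oo, s[) x : R).
Proof.
move=> s0 xI xs; have := xI; rewrite /= in_itv/= => /andP[x0 x1].
have xn0 n : 0 <= x ^+ n by exact: exprn_ge0.
have xn1 n : x ^+ n <= 1 by exact: exprn_ile1.
have N n : (Num.truncn (s^-1 ^+ n))%:R <= s^-1 ^+ n < (Num.truncn (s^-1 ^+ n)).+1%:R.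
  by apply: truncn_itv; rewrite exprn_ge0// invr_ge0 ltW.
rewrite indicE.
case: (ltgtP x s) xs => // [xs|sx] _.
  rewrite mem_set /= ?in_itv//=.
  apply: (@squeeze_cvgr _ _ _ _ (fun n => 1 - (x / s) ^+ n) (fun=> 1)); last 2 first.
  - rewrite -[X in _ --> X]subr0; apply: cvgB; first exact: cvg_cst.
    apply: cvg_expr; rewrite ger0_norm ?divr_ge0 ?(ltW s0)//.
    by rewrite ltr_pdivrMr// mul1r.
  - exact: cvg_cst.
  apply: nearW => n; have /andP[_ ->] := step_ge0_le1 s n xI; rewrite andbT.
  rewrite horner_step; apply: le_trans (bernoulli_le _ _); last first.
    by have := xn1 n; lra.
  rewrite mulrN lerD2l lerN2 exprMn [leRHS]mulrC; apply: ler_wpM2r => //.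
  by have /andP[] := N n.
rewrite memNset /= ?in_itv/=; last by apply/negP; rewrite -leNgt ltW.
apply: (@squeeze_cvgr _ _ _ _ (fun=> 0) (fun n => (s / x) ^+ n)); last 2 first.
- exact: cvg_cst.
- have x0' : 0 < x by exact: lt_trans sx.
  apply: cvg_expr; rewrite ger0_norm ?divr_ge0 ?(ltW s0)//.
  by rewrite ltr_pdivrMr// mul1r.
apply: nearW => n; have /andP[-> _] := step_ge0_le1 s n xI.
rewrite horner_step /=; have x0' : 0 < x by exact: lt_trans sx.
set k := Num.truncn _; have /andP[_] := N n; rewrite -/k => Nk.
have yk : x ^+ n / s ^+ n <= (1 + x ^+ n) ^+ k.
  apply: le_trans (bernoulli_le _ _); last by have := xn0 n; lra.
  (* The exponent was rounded down; the missing term x^n is at most 1 and is absorbed by the 1 in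
     Bernoulli's bound. *)
  rewrite -exprVn mulrC; apply: le_trans (_ : k.+1%:R * x ^+ n <= _).
    by apply: ler_wpM2r => //; exact: ltW.
  by rewrite -natr1 mulrDl mul1r addrC lerD2r.
have -> : (s / x) ^+ n = (x ^+ n / s ^+ n)^-1 by rewrite invf_div expr_div_n.
have q0 : 0 < x ^+ n / s ^+ n by rewrite divr_gt0// exprn_gt0.
rewrite -[leRHS]mul1r ler_pdivlMr//.
apply: le_trans (_ : (1 - x ^+ n) ^+ k * (1 + x ^+ n) ^+ k <= _).
  by apply: ler_wpM2l => //; rewrite exprn_ge0// subr_ge0.
rewrite -exprMn -subr_sqr expr1n exprn_ile1//.
  by rewrite subr_ge0 exprn_ile1.
by rewrite lerBlDr lerDl exprn_ge0.
Qed.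

Lemma eq_moments_atom (m1 m2 : {measure set R -> \bar R}) (s : R) :
  (m1 I01 < +oo)%E -> (m2 I01 < +oo)%E ->
  (forall k, \int[m1]_(x in I01) (x ^+ k) = \int[m2]_(x in I01) (x ^+ k)) ->
  I01 s -> m1 [set s] = m2 [set s].
Proof.
move=> m1oo m2oo m12 sI.
have -> : [set s] = [set s] `&` I01 by apply/esym/setIidl => _ ->.
apply: (@eq_measure_poly_limit m1 m2 _ _ (spike s)) => //.
- by move=> n x xI; exact: spike_le1.
- by move=> x xI; exact: cvg_spike.
- by move=> n; exact: eq_moments_horner.
Qed.

(** The polynomials [step_poly s] may have the wrong limit at [s] itself, so the limit is taken on
    [0, 1] without [s]. The integrals over this smaller set still agree, since both measures give
    the atom at [s] the same mass. *)
Lemma eq_moments_ray (m1 m2 : {measure set R -> \bar R}) (s : R) :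
  (m1 I01 < +oo)%E -> (m2 I01 < +oo)%E ->
  (forall k, \int[m1]_(x in I01) (x ^+ k) = \int[m2]_(x in I01) (x ^+ k)) ->
  m1 (`]-oo, s[ `&` I01) = m2 (`]-oo, s[ `&` I01).
Proof.
move=> m1oo m2oo m12; have [s0|s0] := leP s 0.
  rewrite (_ : _ `&` _ = set0) ?measure0//; apply/seteqP; split=> // x /=.
  rewrite !in_itv/= => -[xs /andP[x0 _]].
  by have := le_lt_trans x0 (lt_le_trans xs s0); rewrite ltxx.
pose D := I01 `\ s.
have mD : measurable D by apply: measurableD.
have -> : `]-oo, s[ `&` I01 = `]-oo, s[ `&` D.
  apply/seteqP; split=> x /= [xs xI]; split=> //; last by case: xI.
  by split=> //= xE; move: xs; rewrite xE in_itv/= ltxx.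
have Doo (m : {measure set R -> \bar R}) : (m I01 < +oo)%E -> (m D < +oo)%E.
  by apply: le_lt_trans; apply: le_measure; rewrite ?inE//; exact: subDsetl.
apply: (@eq_measure_poly_limit m1 m2 D _ (step_poly s)) => //.
- by apply: subDsetl.
- exact: Doo.
- exact: Doo.
- move=> n x [xI _]; have /andP[p0 p1] := step_ge0_le1 s n xI.
  by rewrite ger0_norm.
- by move=> x [xI /eqP xs]; exact: cvg_step.
move=> n; have pE := eq_moments_horner (step_poly s n) m1oo m2oo m12.
have [sI|sI] := pselect (I01 s); last first.
  by rewrite /D (_ : I01 `\ s = I01)// not_setD1//; exact: sI.
have split (m : {measure set R -> \bar R}) : (m I01 < +oo)%E ->
    \int[m]_(x in I01) (step_poly s n).[x] =
    (step_poly s n).[s] * fine (m [set s]) + \int[m]_(x in D) (step_poly s n).[x].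
  move=> moo; have IE : I01 = [set s] `|` D by rewrite /D setD1K.
  rewrite {1}IE Rintegral_setU//.
  - congr (_ + _); rewrite -Rintegral_cst//; apply: eq_Rintegral => x.
    by rewrite inE => ->.
  - by rewrite -IE; exact: integrable_horner01.
  - by apply/disj_setPS => x [-> []] /=.
move: pE; rewrite !split// (eq_moments_atom m1oo m2oo m12 sI).
by move/addrI.
Qed.

(** The open left rays form a pi-system that generates the Borel sets. Restricting both measures to
    [0, 1] makes them finite on the rays, as the uniqueness theorem requires. *)
Theorem eq_moments (m1 m2 : {measure set R -> \bar R}) (A : set R) :
  (m1 I01 < +oo)%E -> (m2 I01 < +oo)%E ->
  (forall k, \int[m1]_(x in I01) (x ^+ k) = \int[m2]_(x in I01) (x ^+ k)) ->
  measurable A -> A `<=` I01 -> m1 A = m2 A.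
Proof.
move=> m1oo m2oo m12 mA AI; have mI : measurable I01 by [].
suff /(_ A mA) : forall B, measurable B -> mrestr m1 mI B = mrestr m2 mI B.
  by rewrite /mrestr setIidl.
apply: (measure_unique (@RGenInftyO.G R) (fun n => `]-oo, n%:R[%classic)).
- exact: RGenInftyO.measurableE.
- move=> _ _ [x ->] [y ->]; exists (Num.min x y); apply/seteqP; split=> z /=.
    by rewrite !in_itv/= lt_min => -[-> ->].
  by rewrite !in_itv/= lt_min => /andP[-> ->].
- by move=> n; exists n%:R.
- apply/seteqP; split=> // x _; exists (Num.truncn x).+1 => //=.
  by rewrite in_itv/=; exact: truncnS_gt.
- by move=> _ [x ->]; exact: eq_moments_ray.
- move=> n; apply: le_lt_trans m1oo; apply: le_measure; rewrite ?inE//.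
  by apply: measurableI.
Qed.

Theorem eq_moments_integral (m1 m2 : {measure set R -> \bar R}) (f : R -> \bar R) :
  (m1 I01 < +oo)%E -> (m2 I01 < +oo)%E ->
  (forall k, \int[m1]_(x in I01) (x ^+ k) = \int[m2]_(x in I01) (x ^+ k)) ->
  (\int[m1]_(x in I01) f x = \int[m2]_(x in I01) f x)%E.
Proof.
by move=> m1oo m2oo m12; apply: eq_measure_integral => A; exact: eq_moments.
Qed.

(** Determinacy applied to the laws of X and Y. Integrating over the preimages of [0, 1] leaves both
    functions free elsewhere, so a value outside [0, 1] can mark points to be discarded. *)
Theorem eq_moments_map d1 d2 (T1 : measurableType d1) (T2 : measurableType d2)
    (m1 : {measure set T1 -> \bar R}) (m2 : {measure set T2 -> \bar R})
    (X : T1 -> R) (Y : T2 -> R) (g : R -> R) (M : R) :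
  measurable_fun setT X -> measurable_fun setT Y -> measurable_fun setT g ->
  (forall x, I01 x -> `|g x| <= M) ->
  (m1 (X @^-1` I01) < +oo)%E -> (m2 (Y @^-1` I01) < +oo)%E ->
  (forall k, \int[m1]_(x in X @^-1` I01) (X x ^+ k) =
             \int[m2]_(y in Y @^-1` I01) (Y y ^+ k)) ->
  (\int[m1]_(x in X @^-1` I01) (g (X x))%:E =
   \int[m2]_(y in Y @^-1` I01) (g (Y y))%:E)%E.
Proof.
move=> mX mY mg gM m1oo m2oo m12.
have mgE : measurable_fun setT (EFin \o g) by exact/measurable_EFinP.
have push d (T : measurableType d) (m : {measure set T -> \bar R}) (Z : T -> R)
    (h : R -> R) N (mZ : measurable_fun setT Z) : (m (Z @^-1` I01) < +oo)%E ->
    measurable_fun setT h -> (forall x, I01 x -> `|h x| <= N) ->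
    (\int[m]_(x in Z @^-1` I01) (h (Z x))%:E =
     \int[pushforward m Z]_(x in I01) (h x)%:E)%E.
  move=> moo mh hN; have mhE : measurable_fun setT (EFin \o h) by exact/measurable_EFinP.
  have mZI : measurable (Z @^-1` I01) by rewrite -[X in measurable X]setTI; exact: mZ.
  have ih : m.-integrable (Z @^-1` I01) ((EFin \o h) \o Z).
    apply: (@integrable_bounded _ _ _ _ _ (h \o Z) N) => // [|x]; last exact: hN.
    by apply: measurable_funTS; exact: measurableT_comp.
  by rewrite (integral_pushforward mZ mhE ih).
rewrite (push _ _ _ _ _ M)// (push _ _ _ _ _ M)//.
apply: eq_moments_integral => // k.
have mk : measurable_fun setT (fun x : R => x ^+ k) by exact: measurable_funX.
have kb x : I01 x -> `|x ^+ k| <= 1.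
  rewrite /= in_itv/= => /andP[x0 x1]; rewrite normrX exprn_ile1//.
  by rewrite ger0_norm.
by rewrite /Rintegral -(push _ _ _ _ _ 1)// -(push _ _ _ _ _ 1)//; exact: m12.
Qed.

End HausdorffMoments.

(** * Bounded measurable functions on a finite measure space *)

Section BoundedMeasurable.
Context d (T : measurableType d) (R : realType).

(** This class is closed under sums, products and powers and consists of integrable functions when
    the measure is finite, so integrability conditions reduce to closure properties. *)
Definition bounded_mfun (f : T -> R) :=
  measurable_fun setT f /\ exists M, forall x, `|f x| <= M.

Lemma bounded_mfun_cst c : bounded_mfun (cst c).
Proof. by split=> //; exists `|c|. Qed.

Lemma bounded_mfunD f g : bounded_mfun f -> bounded_mfun g ->
  bounded_mfun (fun x => f x + g x).
Proof.
move=> [mf [M fM]] [mg [N gN]]; split; first exact: measurable_funD.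
by exists (M + N) => x; apply: le_trans (ler_normD _ _) _; rewrite lerD.
Qed.

Lemma bounded_mfunM f g : bounded_mfun f -> bounded_mfun g ->
  bounded_mfun (fun x => f x * g x).
Proof.
move=> [mf [M fM]] [mg [N gN]]; split; first exact: measurable_funM.
by exists (M * N) => x; rewrite normrM ler_pM.
Qed.

Lemma bounded_mfunZ c f : bounded_mfun f -> bounded_mfun (fun x => c * f x).
Proof. exact/bounded_mfunM/bounded_mfun_cst. Qed.

Lemma bounded_mfunB f g : bounded_mfun f -> bounded_mfun g ->
  bounded_mfun (fun x => f x - g x).
Proof.
move=> bf /(bounded_mfunZ (-1)) bg; have := bounded_mfunD bf bg.
by congr bounded_mfun; apply/funext => x; rewrite mulN1r.
Qed.

Lemma bounded_mfunX n f : bounded_mfun f -> bounded_mfun (fun x => f x ^+ n).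
Proof.
move=> bf; elim: n => [|n IHn]; first exact: (bounded_mfun_cst 1).
have := bounded_mfunM bf IHn.
by congr bounded_mfun; apply/funext => x; rewrite exprS.
Qed.

Variable m : {measure set T -> \bar R}.
Hypothesis moo : (m setT < +oo)%E.

Lemma bounded_mfun_integrable f : bounded_mfun f -> m.-integrable setT (EFin \o f).
Proof. by move=> [mf [M fM]]; apply: integrable_bounded => // x _; exact: fM. Qed.

Lemma bounded_integralE f : bounded_mfun f ->
  (\int[m]_x (f x)%:E)%E = (\int[m]_x f x)%:E.
Proof.
move=> bf; rewrite fineK//; apply: integrable_fin_num => //.
exact: bounded_mfun_integrable.
Qed.

Lemma bounded_RintegralD f g : bounded_mfun f -> bounded_mfun g ->
  \int[m]_x (f x + g x) = \int[m]_x f x + \int[m]_x g x.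
Proof. by move=> bf bg; rewrite RintegralD//; exact: bounded_mfun_integrable. Qed.

Lemma bounded_RintegralB f g : bounded_mfun f -> bounded_mfun g ->
  \int[m]_x (f x - g x) = \int[m]_x f x - \int[m]_x g x.
Proof. by move=> bf bg; rewrite RintegralB//; exact: bounded_mfun_integrable. Qed.

Lemma bounded_RintegralZ c f : bounded_mfun f ->
  \int[m]_x (c * f x) = c * \int[m]_x f x.
Proof. by move=> bf; rewrite RintegralZl//; exact: bounded_mfun_integrable. Qed.

Lemma bounded_le_Rintegral f g : bounded_mfun f -> bounded_mfun g ->
  (forall x, f x <= g x) -> \int[m]_x f x <= \int[m]_x g x.
Proof.
by move=> bf bg fg; apply: le_Rintegral => //; exact: bounded_mfun_integrable.
Qed.

(** Makes the integral of a polynomial in a parameter [s] a polynomial in [s], so that two such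
    integrals can be compared coefficient by coefficient. *)
Lemma bounded_Rintegral_horner (s : R) n (c : nat -> T -> R) :
  (forall l, bounded_mfun (c l)) ->
  \int[m]_x (\sum_(l < n) c l x * s ^+ l) =
  (\poly_(l < n) \int[m]_x c l x).[s].
Proof.
move=> bc; rewrite horner_poly; elim: n => [|n IHn].
  by under eq_Rintegral do rewrite big_ord0; rewrite Rintegral_cst// mul0r big_ord0.
under eq_Rintegral do rewrite big_ord_recr/=.
rewrite bounded_RintegralD ?big_ord_recr/= ?IHn; last 2 first.
- elim: n {IHn} => [|n IHn].
    have := bounded_mfun_cst 0; congr bounded_mfun.
    by apply/funext => x; rewrite big_ord0.
  have := bounded_mfunD IHn (bounded_mfunM (bc n) (bounded_mfun_cst (s ^+ n))).
  by congr bounded_mfun; apply/funext => x; rewrite big_ord_recr.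
- exact/bounded_mfunM/bounded_mfun_cst.
congr (_ + _); under eq_Rintegral do rewrite mulrC.
by rewrite bounded_RintegralZ// mulrC.
Qed.

End BoundedMeasurable.

(** The difference would vanish at all natural numbers, which are distinct in characteristic 0,
    hence at as many points as its size. *)
Lemma horner_inj (R : numDomainType) (p q : {poly R}) :
  (forall x, p.[x] = q.[x]) -> p = q.
Proof.
move=> pq; apply/eqP; rewrite -subr_eq0; apply/eqP.
apply: (@roots_geq_poly_eq0 _ _ [seq n%:R | n <- iota 0 (size (p - q))]).
- by apply/allP => x _; rewrite rootE hornerD hornerN pq subrr.
- by rewrite map_inj_uniq ?iota_uniq//; exact: (mulrIn (oner_neq0 R)).
- by rewrite size_map size_iota.
Qed.

(** * Euclidean inner product and orthogonal matrices *)

Section DotGeometry.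
Variable R : realType.
Notation E3 := 'rV[R]_3.
Implicit Types (u v n x y : E3) (Q : 'M[R]_3).

Lemma dot_mxE u v : u *m v^T = (dot u v)%:M.
Proof.
apply/matrixP => i j; rewrite !ord1 !mxE eqxx mulr1n.
by apply: eq_bigr => k _; rewrite mxE.
Qed.

Lemma dot_delta (i : 'I_3) u : dot (delta_mx ord0 i) u = u ord0 i.
Proof.
rewrite /dot (bigD1 i)//= big1 => [|j ji]; rewrite mxE ?eqxx ?mul1r ?addr0//=.
by rewrite (negbTE ji) mul0r.
Qed.

Lemma sphere2_delta (i : 'I_3) : sphere2 (delta_mx ord0 i : E3).
Proof. by rewrite /sphere2 /= dot_delta mxE !eqxx. Qed.

Lemma dot0l u : dot 0 u = 0.
Proof. by rewrite -(scale0r 0) dotZl mul0r. Qed.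

Lemma cauchy_schwarz_dot u v : dot u v ^+ 2 <= dot u u * dot v v.
Proof.
have [v0|v0] := eqVneq (dot v v) 0.
  by rewrite (dot_eq0 v0) dotC !dot0l expr0n mulr0.
have vp : 0 < dot v v by rewrite lt_def v0 dot_ge0.
have := dot_ge0 (dot v v *: u - dot u v *: v).
rewrite !(dotDl, dotDr, dotNl, dotNr, dotZl, dotZr) (dotC v u) => h.
have : 0 <= dot v v * (dot u u * dot v v - dot u v ^+ 2) by nra.
by rewrite pmulr_rge0// subr_ge0.
Qed.

Lemma sphere2_dot_le1 u v : sphere2 u -> sphere2 v -> `|dot u v| <= 1.
Proof.
move=> uS vS; rewrite -(@expr_le1 _ 2)// real_normK ?num_real//.
by apply: le_trans (cauchy_schwarz_dot u v) _; rewrite uS vS mulr1.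
Qed.

Lemma dot_mulmx Q u v : dot (u *m Q) v = dot u (v *m Q^T).
Proof.
have /matrixP/(_ ord0 ord0) : (dot (u *m Q) v)%:M = (dot u (v *m Q^T))%:M :> 'M[R]_1.
  by rewrite -!dot_mxE trmx_mul trmxK mulmxA.
by rewrite !mxE !eqxx !mulr1n.
Qed.

Lemma orthogonal_dot Q u v : Q *m Q^T = 1%:M -> dot (u *m Q) (v *m Q) = dot u v.
Proof. by move=> QQ; rewrite dot_mulmx -mulmxA QQ mulmx1. Qed.

Lemma orthogonal_trmx Q : Q *m Q^T = 1%:M -> Q^T *m Q = 1%:M.
Proof. by move/mulmx1C. Qed.

(** For distinct unit vectors, the reflection in the plane orthogonal to u - v exchanges them. *)
Lemma orthogonal_transitive u v : sphere2 u -> sphere2 v ->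
  exists2 Q, Q *m Q^T = 1%:M & u *m Q = v.
Proof.
rewrite /sphere2 /= => uS vS; have [->|uv] := eqVneq u v.
  by exists 1%:M; rewrite ?trmx1 mulmx1.
pose a := u - v; pose c := 2 / dot a a.
have aa : dot a a != 0.
  by apply: contra_neq uv => /dot_eq0/eqP; rewrite subr_eq0 => /eqP.
pose A := a^T *m a; pose Q : 'M[R]_3 := 1%:M - c *: A.
have QT : Q^T = Q by rewrite /Q /A linearB/= linearZ/= trmx1 trmx_mul trmxK.
have AA : A *m A = dot a a *: A.
  by rewrite mulmxA -(mulmxA _ a) dot_mxE mul_mx_scalar -scalemxAl.
exists Q; rewrite ?QT /Q.
  rewrite mulmxBl mul1mx -scalemxAl mulmxBr mulmx1 -scalemxAr AA scalerA.
  have -> : c * dot a a = 1 + 1 by rewrite /c; field.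
  by rewrite scalerDl !scale1r opprD addrA subrr add0r scalerN opprK subrK.
rewrite mulmxBr mulmx1 -scalemxAr /A mulmxA dot_mxE mul_scalar_mx scalerA.
have -> : c * dot u a = 1.
  have aE : dot a a = 2 * dot u a.
    by rewrite /a !(dotDl, dotDr, dotNl, dotNr) (dotC v u) uS vS; ring.
  by rewrite /c aE; field; apply: contra_neq aa; rewrite aE => ->; rewrite mulr0.
by rewrite scale1r opprB addrC subrK.
Qed.

Lemma hplane_mulmx Q u t : Q *m Q^T = 1%:M ->
  [set x *m Q | x in hplane u t] = hplane (u *m Q) t.
Proof.
move=> QQ; apply/seteqP; split=> [_ [x xu <-]|x]; rewrite /hplane /=.
  by rewrite orthogonal_dot.
move=> xu; exists (x *m Q^T); last by rewrite -mulmxA (orthogonal_trmx QQ) mulmx1.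
by rewrite /hplane /= -dot_mulmx.
Qed.

Lemma dot_plane_normal2 u t x : sphere2 u ->
  dot x (plane_normal (hplane u t)) ^+ 2 = dot x u ^+ 2.
Proof. by move=> uS; rewrite normal_hplane//; case: ifP => _; rewrite ?dotNr ?sqrrN. Qed.

Lemma measurable_dot d (T : measurableType d) (f g : T -> borel3 R) :
  measurable_fun setT f -> measurable_fun setT g ->
  measurable_fun setT (fun z => dot (f z : E3) (g z)).
Proof.
move=> mf mg; have mc i : measurable_fun setT (fun u : borel3 R => (u : E3) ord0 i).
  by apply: borel3_continuous_measurable; exact: coord_continuous.
apply: (@measurable_sum _ _ R setT _ _
  (fun i z => (f z : E3) ord0 i * (g z : E3) ord0 i)) => i.
by apply: measurable_funM; apply: (measurableT_comp (mc i)).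
Qed.

End DotGeometry.

(** * Zonal moments of the invariant measure *)

Section NormalLaw.
Variable R : realType.
Variable nu : {finite_measure set (grplane R) -> \bar R}.
Hypothesis nu_inv : rotation_invariant nu.
Hypothesis nu_mass : nu [set: grplane R] = (2 * pi)%:E.
Notation E3 := 'rV[R]_3.
Implicit Types (u v n x y : E3) (Q : 'M[R]_3).

Lemma nu_setT_lty : (nu setT < +oo)%E.
Proof. by rewrite nu_mass ltry. Qed.

(* In odd dimension one of [Q] and [- Q] is a rotation, and both act in the same
   way on planes through the origin. *)
Lemma orthogonal_invariant Q (B : set (grplane R)) : Q *m Q^T = 1%:M ->
  measurable B ->
  nu [set P : grplane R | exists2 P0 : grplane R, B P0 &
        (P : set E3) = [set x *m Q | x in (P0 : set E3)]] = nu B.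
Proof.
move=> QQ mB.
have : \det Q ^+ 2 = 1 by rewrite expr2 -{2}det_tr -det_mulmx QQ det1.
move=> /eqP; rewrite sqrf_eq1 => /orP[/eqP dQ|/eqP dQ]; first exact: nu_inv.
rewrite -(nu_inv (Q := - Q) _ _ mB); last 2 first.
- by rewrite linearN/= mulmxN mulNmx opprK.
- by rewrite -scaleN1r detZ dQ mulrN1 -signr_odd expr1 opprK.
have N0 w : hplane (- w) 0 = hplane w 0 by rewrite -[in LHS]oppr0 hplaneN.
congr (nu _); apply/seteqP; split=> P [P0 BP0 PE]; exists P0 => //; rewrite PE;
  have [u uS ->] := grplaneP P0; rewrite !hplane_mulmx// ?linearN/=;
  by rewrite ?mulmxN ?mulNmx ?opprK// N0.
Qed.

Lemma measurable_dot_normal u :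
  measurable_fun setT (fun P : grplane R => dot u (plane_normal P)).
Proof.
apply: (@measurable_dot _ _ _ (cst u)); first exact: measurable_cst.
exact: measurable_normal.
Qed.

(** An orthogonal matrix taking [u] to [v] maps the first set of planes onto the second. The square
    makes both sets independent of the sign chosen for the normal. *)
Lemma dot_normal_law u v (B : set R) : sphere2 u -> sphere2 v -> measurable B ->
  nu [set P : grplane R | B (dot u (plane_normal P) ^+ 2)] =
  nu [set P : grplane R | B (dot v (plane_normal P) ^+ 2)].
Proof.
move=> uS vS mB; have [Q QQ uQ] := orthogonal_transitive uS vS.
have mS : measurable [set P : grplane R | B (dot u (plane_normal P) ^+ 2)].
  have := measurable_funX 2 (measurable_dot_normal u).
  by move=> /(_ measurableT _ mB); rewrite setTI.
rewrite -(orthogonal_invariant QQ mS); congr (nu _).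
apply/seteqP; split=> [P [P0 BP0 PE]|P BP] /=.
  have [nS nE] := normal_grplane P0.
  rewrite PE nE hplane_mulmx// dot_plane_normal2 -?uQ ?orthogonal_dot//.
  by rewrite /sphere2 /= orthogonal_dot.
have [nS nE] := normal_grplane P; set n := plane_normal P in nS nE *.
have nQS : sphere2 (n *m Q^T).
  by rewrite /sphere2 /= orthogonal_dot ?trmxK//; exact: orthogonal_trmx.
exists (gr_hplane nQS) => /=.
  by rewrite dot_plane_normal2// -dot_mulmx uQ.
by rewrite hplane_mulmx// -mulmxA (orthogonal_trmx QQ) mulmx1.
Qed.

Lemma bounded_dot_normal u : sphere2 u ->
  bounded_mfun (fun P : grplane R => dot u (plane_normal P)).
Proof.
move=> uS; split; first exact: measurable_dot_normal.
exists 1 => P; apply: sphere2_dot_le1 => //.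
by have [] := normal_grplane P.
Qed.

Definition zonal_moment k u := \int[nu]_P (dot u (plane_normal P) ^+ (2 * k)).

Lemma zonal_moment_cst k u v : sphere2 u -> sphere2 v ->
  zonal_moment k u = zonal_moment k v.
Proof.
move=> uS vS.
have mX w := measurable_funX 2 (measurable_dot_normal w).
(* The integrand is written as |x|^k at x = <w, n>^2: the absolute value makes it nonnegative on the
   whole line, where the law of <w, n>^2 is considered. *)
have push w : (\int[nu]_P (dot w (plane_normal P) ^+ (2 * k))%:E)%E =
  (\int[pushforward nu (fun P : grplane R => dot w (plane_normal P) ^+ 2)%R]_x
    (`|x| ^+ k)%:E)%E.
  rewrite ge0_integral_pushforward//.
    apply: eq_integral => P _ /=.
    by rewrite exprM ger0_norm// sqr_ge0.
  apply/measurable_EFinP; apply: measurable_funX; exact: normr_measurable.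
rewrite /zonal_moment /Rintegral !push; congr fine.
apply: eq_measure_integral => A mA _.
exact: dot_normal_law.
Qed.

End NormalLaw.

(** * Recurrence for the zonal moments *)

Section ZonalMoments.
Variable R : realType.
Variable nu : {finite_measure set (grplane R) -> \bar R}.
Hypothesis nu_inv : rotation_invariant nu.
Hypothesis nu_mass : nu [set: grplane R] = (2 * pi)%:E.
Notation E3 := 'rV[R]_3.
Let nuoo := nu_setT_lty nu_mass.

Lemma coef2_expr_1DX2 k : (((1 + 'X^2) ^+ k : {poly R})`_2) = k%:R.
Proof.
elim: k => [|k IHk]; first by rewrite expr0 coef1.
rewrite exprS mulrDl mul1r coefD IHk coefXnM/= -natr1; congr (_ + _).
by rewrite -horner_coef0 !hornerE expr0n/= addr0 expr1n.
Qed.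

(* The coefficient of [s ^ 2] in the identity
   [int (x + s y) ^ (2k) = (1 + s ^ 2) ^ k * int x ^ (2k)]. *)
Lemma zonal_mixed_moment k (i j : 'I_3) : i != j ->
  \int[nu]_P (plane_normal P ord0 i ^+ (2 * k) * plane_normal P ord0 j ^+ 2) =
  zonal_moment nu k.+1 (delta_mx ord0 i) / (2 * k + 1)%:R.
Proof.
move=> ij; set m := (2 * k.+1)%N; set M := zonal_moment _ _ _.
pose x (P : grplane R) := plane_normal P ord0 i : R.
pose y (P : grplane R) := plane_normal P ord0 j : R.
have bx : bounded_mfun x.
  rewrite (_ : x = fun P : grplane R => dot (delta_mx ord0 i) (plane_normal P)).
    by apply: bounded_dot_normal; exact: sphere2_delta.
  by apply/funext => P; rewrite dot_delta.
have by_ : bounded_mfun y.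
  rewrite (_ : y = fun P : grplane R => dot (delta_mx ord0 j) (plane_normal P)).
    by apply: bounded_dot_normal; exact: sphere2_delta.
  by apply/funext => P; rewrite dot_delta.
pose c l P := 'C(m, l)%:R * (x P ^+ (m - l) * y P ^+ l).
have bc l : bounded_mfun (c l).
  by apply: bounded_mfunZ; apply: bounded_mfunM; exact: bounded_mfunX.
have pE : \poly_(l < m.+1) \int[nu]_P c l P = M *: (1 + 'X^2) ^+ k.+1.
  apply: horner_inj => s; rewrite -bounded_Rintegral_horner//.
  have s0 : 0 < 1 + s ^+ 2 by rewrite ltr_pwDl// sqr_ge0.
  (* The vector e_i + s e_j has length [r]. Its moment of order 2(k + 1) is therefore r^(2(k + 1))
     times that of the unit vector r^-1 u, which is [M]. *)
  pose r := Num.sqrt (1 + s ^+ 2); pose u : E3 := delta_mx ord0 i + s *: delta_mx ord0 j.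
  have r0 : r != 0 by rewrite gt_eqF// sqrtr_gt0.
  have rr : r ^+ 2 = 1 + s ^+ 2 by rewrite sqr_sqrtr// ltW.
  have uu : dot u u = 1 + s ^+ 2.
    rewrite /u !(dotDl, dotDr, dotZl, dotZr) !dot_delta !mxE !eqxx /=.
    by rewrite (negbTE ij) eq_sym (negbTE ij)/=; ring.
  have uS : sphere2 (r^-1 *: u).
    by rewrite /sphere2 /= dotZl dotZr uu mulrA -expr2 exprVn rr mulVf// gt_eqF.
  rewrite hornerZ !hornerE /M.
  rewrite (zonal_moment_cst nu_inv k.+1 (sphere2_delta R i) uS) /zonal_moment mulrC.
  rewrite -bounded_RintegralZ//; last exact/bounded_mfunX/bounded_dot_normal.
  apply: eq_Rintegral => P _; rewrite dotZl exprMn -/m.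
  rewrite exprM exprVn rr mulrA -exprMn divff ?gt_eqF// expr1n mul1r.
  rewrite dotDl dotZl !dot_delta -/(x P) -/(y P) exprDn.
  apply: eq_bigr => l _; rewrite exprMn /c -[RHS]mulr_natl; ring.
have := congr1 (fun p : {poly R} => p`_2) pE.
have m2 : (2 < m.+1)%N by rewrite /m mulnS.
rewrite coefZ coef2_expr_1DX2 coef_poly m2 /c bounded_RintegralZ//; last first.
  by apply: bounded_mfunM; exact: bounded_mfunX.
have mk : (m - 2 = 2 * k)%N by rewrite /m mulnS addKn.
rewrite mk -/(x _) => h.
(* The factor k + 1 of this binomial cancels against the coefficient of s^2 in (1 + s^2)^(k + 1),
   and 2k + 1 remains. *)
have bin : 'C(m, 2)%:R = k.+1%:R * (2 * k + 1)%:R :> R.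
  have b2 : ('C(m, 2) * 2 = m * m.-1)%N.
    by rewrite -[X in (_ * X)%N = _]/(2`!) bin_ffact ffactnS ffactn1.
  apply: (@mulIf R 2); rewrite ?pnatr_eq0// -!natrM b2.
  by congr _%:R; rewrite /m mulnS /= addn1; lia.
have k0 : k.+1%:R != 0 :> R by rewrite pnatr_eq0.
have k1 : (2 * k + 1)%:R != 0 :> R by rewrite pnatr_eq0 addn1.
apply: (mulfI k0); rewrite [in RHS]mulrA [_ * M]mulrC -h bin.
by field.
Qed.

(** Inserting n_0^2 + n_1^2 + n_2^2 = 1 splits the moment of order 2k into the moment M of order 2(k
    + 1) and two mixed moments, each equal to M / (2k + 1). *)
Lemma zonal_momentS k (i : 'I_3) :
  zonal_moment nu k (delta_mx ord0 i) =
  zonal_moment nu k.+1 (delta_mx ord0 i) * (2 * k + 3)%:R / (2 * k + 1)%:R.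
Proof.
pose z l (P : grplane R) := plane_normal P ord0 l : R.
have bz l : bounded_mfun (z l).
  rewrite (_ : z l = fun P : grplane R => dot (delta_mx ord0 l) (plane_normal P)).
    by apply: bounded_dot_normal; exact: sphere2_delta.
  by apply/funext => P; rewrite dot_delta.
have zE l : zonal_moment nu l (delta_mx ord0 i) = \int[nu]_P (z i P ^+ (2 * l)).
  by apply: eq_Rintegral => P _; rewrite dot_delta.
pose f (l : 'I_3) (P : grplane R) := z i P ^+ (2 * k) * z l P ^+ 2.
have bf l : bounded_mfun (f l) by apply: bounded_mfunM; exact: bounded_mfunX.
have k1 : (2 * k + 1)%:R != 0 :> R by rewrite pnatr_eq0 addn1.
have sumE : zonal_moment nu k (delta_mx ord0 i) = \sum_l \int[nu]_P f l P.
  transitivity (\int[nu]_P (f ord0 P + (f (lift ord0 ord0) P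
      + f (lift ord0 (lift ord0 ord0)) P))).
    rewrite zE; apply: eq_Rintegral => P _; rewrite /f -!mulrDr.
    have [+ _] := normal_grplane P; rewrite /sphere2 /= /dot !big_ord_recl big_ord0 addr0.
    by rewrite -!expr2 => ->; rewrite mulr1.
  rewrite !big_ord_recl big_ord0 addr0.
  by rewrite !bounded_RintegralD//; exact: bounded_mfunD.
rewrite sumE (bigD1 i)//=.
rewrite (eq_bigr (fun=> zonal_moment nu k.+1 (delta_mx ord0 i) / (2 * k + 1)%:R)); last first.
  by move=> j ji; rewrite -(zonal_mixed_moment k (i := i) (j := j)) 1?eq_sym.
rewrite sumr_const cardC1 card_ord.
rewrite (_ : \int[nu]_P f i P = zonal_moment nu k.+1 (delta_mx ord0 i)).
  rewrite (_ : (2 * k + 3)%:R = (2 * k + 1)%:R + 2 :> R); last first.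
    by rewrite -natrD -addnA.
  by rewrite /= -mulr_natl; field.
by rewrite zE; apply: eq_Rintegral => P _; rewrite /f -exprD mulnS addnC.
Qed.

Lemma zonal_momentE k u : sphere2 u ->
  zonal_moment nu k u = 2 * pi / (2 * k + 1)%:R.
Proof.
move=> uS; rewrite (zonal_moment_cst nu_inv k uS (sphere2_delta R ord0)).
elim: k => [|k IHk].
  rewrite /zonal_moment; under eq_Rintegral do rewrite muln0 expr0.
  rewrite Rintegral_cst// [X in fine X](_ : _ = (2 * pi)%:E); last exact: nu_mass.
  by rewrite mul1r /= divr1.
have k1 : (2 * k + 1)%:R != 0 :> R by rewrite pnatr_eq0 addn1.
have k3 : (2 * k + 3)%:R != 0 :> R by rewrite pnatr_eq0 addn3.
have := zonal_momentS k ord0; rewrite IHk => h.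
have -> : (2 * k.+1 + 1)%N = (2 * k + 3)%N by lia.
apply: (mulIf k3); rewrite divfK//; apply: (mulIf (invr_neq0 k1)).
by rewrite -h.
Qed.

End ZonalMoments.

(** * Support function and width *)

Section SupportFunction.
Variable R : realType.
Notation E3 := 'rV[R]_3.
Variable K : set E3.
Hypothesis K0 : K !=set0.
Hypothesis K_compact : compact K.
Hypothesis K_convex : convex_set (K : set (convex_lmodType E3)).
Implicit Types (u v x y : E3).
Notation p := (support_function K).

Lemma continuous_dotl u : continuous (fun x : E3 => dot x u).
Proof.
apply: (@continuous_big R _ +%R 0 xpredT) => [z|i _ x].
  exact: (@add_continuous R^o).
have c := @coord_continuous R 1 3 ord0 i x.
by apply: (@cvgM R E3 (nbhs x) _ _ _ _ _ c); exact: cvg_cst.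
Qed.

Lemma support_attained u : exists2 x, K x & p u = dot x u.
Proof.
have [|x xK xmax] := compact_EVT_max K0 K_compact (f := fun x => dot x u).
  by apply: continuous_subspaceT; exact: continuous_dotl.
rewrite inE in xK; exists x => //; apply/eqP; rewrite eq_le; apply/andP; split.
  apply: ge_sup; first by exists (dot x u), x.
  by move=> _ [y yK <-]; apply: xmax; rewrite inE.
apply: ub_le_sup; last by exists x.
by exists (dot x u) => _ [y yK <-]; apply: xmax; rewrite inE.
Qed.

Lemma dot_le_support u x : K x -> dot x u <= p u.
Proof.
move=> xK; have [|y yK ymax] := compact_EVT_max K0 K_compact (f := fun x => dot x u).
  by apply: continuous_subspaceT; exact: continuous_dotl.
apply: ub_le_sup; last by exists x.
by exists (dot y u) => _ [z zK <-]; apply: ymax; rewrite inE.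
Qed.

Lemma support_range u : - p (- u) <= p u.
Proof.
have [x xK] := K0; have := dot_le_support u xK; have := dot_le_support (- u) xK.
by rewrite dotNr; lra.
Qed.

(** On K the values of <x, u> run from -p(-u) to p(u); by convexity the segment between two points
    attaining these extremes meets every plane in between. *)
Lemma hplane_meets u s :
  (hplane u s `&` K !=set0) <-> - p (- u) <= s <= p u.
Proof.
split=> [[x [xu xK]]|/andP[ls su]].
  have := dot_le_support u xK; have := dot_le_support (- u) xK.
  by move: xu; rewrite /hplane /= dotNr (dotC u) => -> h1 h2; apply/andP; split; lra.
have [x xK px] := support_attained u; have [y yK py] := support_attained (- u).
(* Zero width is treated apart, because the weight [t] below divides by the width. *)
have [e|ne] := eqVneq (- p (- u)) (p u).
  by exists x; split=> //; rewrite /hplane /= dotC -px; lra.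
have d0 : 0 < p u + p (- u).
  have := support_range u; rewrite le_eqVlt (negbTE ne)/=; lra.
(* The solution of t p(u) - (1 - t) p(-u) = s. *)
pose t := (s + p (- u)) / (p u + p (- u)).
have t0 : 0 <= t by rewrite divr_ge0 ?(ltW d0)//; lra.
have t1 : t <= 1 by rewrite ler_pdivrMr// mul1r; lra.
have := K_convex (Itv01 t0 t1) (mem_set xK) (mem_set yK).
rewrite inE => zK; eexists; split; last exact: zK.
rewrite /hplane /= dotDr !dotZr (dotC u x) (dotC u y) -px.
have -> : dot y u = - p (- u) by rewrite py dotNr opprK.
change (t * p u + (1 - t) * - p (- u) = s); rewrite /t; field; lra.
Qed.

Lemma dot_self_bounded : exists2 C, 0 <= C & forall x, K x -> dot x x <= C.
Proof.
have [|x xK xmax] := compact_EVT_max K0 K_compact (f := fun x => dot x x).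
  by apply: continuous_subspaceT; exact: dotvv_continuous.
by exists (dot x x) => [|y yK]; [exact: dot_ge0|apply: xmax; rewrite inE].
Qed.

(** If x attains p(u), then p(u) - p(v) <= <x, u - v>; Cauchy-Schwarz concludes, with C a bound for
    <x, x> on K. *)
Lemma support_lipschitz : exists2 C, 0 <= C &
  forall u v, (p u - p v) ^+ 2 <= C * dot (u - v) (u - v).
Proof.
have [C C0 CK] := dot_self_bounded; exists C => // u v.
wlog puv : u v / p v <= p u.
  move=> h; have [|/ltW] := leP (p v) (p u); first exact: h.
  move=> /h; rewrite -opprB sqrrN; congr (_ <= _ * _).
  by rewrite -(opprB u v) dotNl dotNr opprK.
have [x xK px] := support_attained u; have := dot_le_support v xK => xv.
apply: le_trans (_ : dot x (u - v) ^+ 2 <= _).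
  by rewrite dotDr dotNr -px ler_sqr ?nnegrE ?subr_ge0//; lra.
apply: le_trans (cauchy_schwarz_dot _ _) _.
by apply: ler_wpM2r; [exact: dot_ge0|exact: CK].
Qed.

Lemma support_continuous : continuous p.
Proof.
have [C C0 pC] := support_lipschitz => u.
apply/(@cvgrPdist_lt _ R^o E3 (nbhs u)) => e e0.
have c : (fun v : E3 => C * dot (u - v) (u - v)) v @[v --> u] --> C * dot (u - u) (u - u).
  have cs : (fun v : E3 => u - v) @ u --> u - u.
    exact: (@cvgB R E3 E3 (nbhs u) _ (fun=> u) id u u (cvg_cst u) cvg_id).
  have cd := cvg_comp _ _ cs (@dotvv_continuous R (u - u)).
  exact: (@cvgM R E3 (nbhs u) _ _ _ _ _ (cvg_cst C) cd).
rewrite subrr dot0l mulr0 in c.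
have {}c := (@cvgrPdist_lt _ R^o E3 (nbhs u) _ _ _).1 c (e ^+ 2) (exprn_gt0 2 e0).
near=> v; have : `|0 - C * dot (u - v) (u - v)| < e ^+ 2 by near: v; exact: c.
rewrite sub0r normrN ger0_norm; last by rewrite mulr_ge0// dot_ge0.
move=> h; rewrite -(@ltr_pXn2r _ 2)// ?nnegrE ?(ltW e0)//.
by rewrite real_normK ?num_real//; exact: le_lt_trans (pC u v) h.
Unshelve. all: by end_near. Qed.

Lemma measurable_support : measurable_fun setT (p : borel3 R -> R).
Proof. by apply: borel3_continuous_measurable; exact: support_continuous. Qed.

Lemma widthN u : width K (- u) = width K u.
Proof. by rewrite /width opprK addrC. Qed.

Lemma width_ge0 u : 0 <= width K u.
Proof. by rewrite /width; have := support_range u; lra. Qed.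

(** Let t = <u, v>. When t >= 0, both p(u) - p(v) and p(-u) - p(-v) have square at most C |u - v|^2
    = 2 C (1 - t), so their sum has square at most 8 C (1 - t) <= 8 C (1 - t^2). When t < 0, [v] is
    replaced by -v, which has the same width. *)
Lemma width_lipschitz : exists2 C, 0 <= C & forall u v, sphere2 u -> sphere2 v ->
  (width K u - width K v) ^+ 2 <= C * (1 - dot u v ^+ 2).
Proof.
have [C C0 pC] := support_lipschitz; exists (8 * C); first by rewrite mulr_ge0.
move=> u v uS vS.
have key v' : sphere2 v' -> 0 <= dot u v' ->
    (width K u - width K v') ^+ 2 <= 8 * C * (1 - dot u v' ^+ 2).
  move=> vS' uv.
  have uu : dot (u - v') (u - v') = 2 - 2 * dot u v'.
    by rewrite !(dotDl, dotDr, dotNl, dotNr) (dotC v' u) uS vS'; ring.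
  have h1 := pC u v'; have := pC (- u) (- v').
  rewrite -opprD dotNl dotNr opprK => h2.
  have t1 : dot u v' <= 1.
    by have := sphere2_dot_le1 uS vS'; rewrite ler_norml => /andP[].
  rewrite uu in h1 h2; rewrite /width; set a := p u in h1 *; set b := p v' in h1 *.
  set a' := p (- u) in h2 *; set b' := p (- v') in h2 *; set t := dot u v' in uv t1 h1 h2 *.
  have h3 : 0 <= C * (t * (1 - t)) by rewrite !mulr_ge0// subr_ge0.
  by have := sqr_ge0 (a - b - (a' - b')); nra.
have [uv|uv] := leP 0 (dot u v); first exact: key.
have := key (- v); rewrite sphere2N widthN dotNr sqrrN; apply => //.
by rewrite oppr_ge0 ltW.
Qed.

Lemma width_bounded : exists M, forall u, sphere2 u -> `|width K u| <= M.
Proof.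
have [C C0 wC] := width_lipschitz.
(* The squared difference d^2 of the two widths is at most C, and d <= 1 + d^2. *)
exists (width K (delta_mx ord0 ord0) + (1 + C)) => u uS.
rewrite ger0_norm ?width_ge0//.
have eS := sphere2_delta R ord0; have := wC _ _ uS eS.
have := sqr_ge0 (dot u (delta_mx ord0 ord0)).
have : 0 <= C * dot u (delta_mx ord0 ord0) ^+ 2 by rewrite mulr_ge0// sqr_ge0.
by set a := width K u; set b := width K _; nra.
Qed.

End SupportFunction.

(** * Planes hitting a convex body *)

(* Without s-finiteness [plane_measure nu] is only a sigma-finite content for the
   inference of structures, and Tonelli does not apply to its square. *)
Section PlaneMeasureSFinite.
Variables (R : realType) (nu : {finite_measure set (grplane R) -> \bar R}).

Let plane_measure_sfinite : sfinite_measure (plane_measure nu).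
Proof. by apply: sfinite_measure_sigma_finite; exact: sigma_finiteT. Qed.

HB.instance Definition _ := isSFinite.Build _ _ _ (plane_measure nu)
  plane_measure_sfinite.

End PlaneMeasureSFinite.

Section PlanesHitting.
Variable R : realType.
Notation E3 := 'rV[R]_3.
Variable nu : {finite_measure set (grplane R) -> \bar R}.
Variable K : set E3.
Hypothesis K0 : K !=set0.
Hypothesis K_compact : compact K.
Hypothesis K_convex : convex_set (K : set (convex_lmodType E3)).
Notation p := (support_function K).

Lemma plane_normal_translate (P : grplane R) s :
  plane_normal (gr_translate P (s *: plane_normal P)) = plane_normal P.
Proof.
have [nS nE] := normal_grplane P.
rewrite gr_translate_normal normal_hplane// [RHS](_ : _ = plane_normal (hplane (plane_normal P) 0)).
  by rewrite normal_hplane.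
by rewrite -nE.
Qed.

(** The normal ignores the offset, so its preimages in S^2 x R are products with the whole line, and
    the case of planes through the origin applies. *)
Lemma measurable_aff_normal :
  measurable_fun setT (fun E : affplane R => plane_normal E : borel3 R).
Proof.
move=> _ A mA; rewrite setTI /measurable /= /aff_measurable /=.
rewrite (_ : aff_preimage _ =
  gr_preimage ((fun P : grplane R => plane_normal P : borel3 R) @^-1` A) `*` setT).
  apply: measurableX => //.
  by have := @measurable_normal R measurableT _ mA; rewrite setTI.
apply/seteqP; split=> -[u t] /=.
  move=> [uS [E AE Eu]]; do 2 split=> //; exists (gr_hplane uS) => //=.
  by move: AE; rewrite /= Eu !normal_hplane.
move=> [[uS [P AP Pu]] _]; split=> //; exists (aff_hplane t uS) => //=.
by move: AP; rewrite /= Pu !normal_hplane.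
Qed.

Lemma measurable_hits : measurable (hits K).
Proof.
rewrite /measurable /= /aff_measurable /=.
have mp := measurable_support K0 K_compact.
rewrite (_ : aff_preimage _ = [set ut : borel3 R * R | sphere2 ut.1] `&`
  ((fun ut : borel3 R * R => p ut.1 - ut.2) @^-1` `[0, +oo[ `&`
   (fun ut : borel3 R * R => ut.2 + p (- (ut.1 : E3))) @^-1` `[0, +oo[)).
  apply: measurableI; first exact: measurable_sphere2R.
  apply: measurableI; rewrite -[X in measurable X]setTI.
    suff : measurable_fun setT (fun ut : borel3 R * R => p ut.1 - ut.2) by apply.
    by apply: measurable_funB => //; exact: (measurableT_comp mp).
  suff : measurable_fun setT (fun ut : borel3 R * R => ut.2 + p (- (ut.1 : E3))) by apply.
  apply: measurable_funD => //; apply: (measurableT_comp mp).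
  by apply: (measurableT_comp (@borel3_opp_measurable R)).
apply/seteqP; split=> -[u t] /=; rewrite !in_itv/= !andbT subr_ge0.
  move=> [uS [E hE Eu]]; split=> //; move: hE; rewrite /hits /= Eu.
  by move=> /(hplane_meets K0 K_compact K_convex)/andP/=[h1 h2]; split; lra.
move=> [uS [h1 h2]]; split=> //; exists (aff_hplane t uS) => //=.
by apply/(hplane_meets K0 K_compact K_convex)/andP; split=> //; lra.
Qed.

(** For a fixed direction n the offsets of the planes meeting K fill the interval [-p(-n), p(n)],
    whose length is the width. *)
Lemma integral_hits (h : E3 -> \bar R) :
  measurable_fun setT (h : borel3 R -> \bar R) -> (forall u, (0 <= h u)%E) ->
  (\int[plane_measure nu]_(E in hits K) h (plane_normal E) =
   \int[nu]_P (h (plane_normal P) * (width K (plane_normal P))%:E))%E.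
Proof.
move=> mh h0; rewrite integral_mkcond plane_measure_integral; last 2 first.
- apply/(measurable_restrictT _ measurable_hits); apply: measurable_funTS.
  exact: (measurableT_comp mh measurable_aff_normal).
- by move=> E; apply: erestrict_ge0 => ? _.
apply: eq_integral => P _; set n := plane_normal P.
have [nS nE] := normal_grplane P.
transitivity (\int[lebesgue_measure]_(s in `[(- p (- n))%R, p n]) h n)%E.
  rewrite [RHS]integral_mkcond; apply: eq_integral => s _.
  rewrite /patch plane_normal_translate -/n.
  have e : (gr_translate P (s *: n) \in hits K) = (s \in `[- p (- n), p n]%classic).
    have hE : hits K (gr_translate P (s *: n)) <-> - p (- n) <= s <= p n.
      by rewrite -(hplane_meets K0 K_compact K_convex n s) /n -gr_translate_normal.
    by apply/idP/idP; rewrite !inE /= in_itv/=; apply hE.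
  by rewrite e.
rewrite integral_cst//= lebesgue_measure_itv/= lte_fin; congr (_ * _)%E.
(* When the width is zero the interval is a single point, and the measure formula for intervals
   falls into its other branch. *)
have := support_range K0 K_compact n; rewrite le_eqVlt => /orP[/eqP e|->].
  by rewrite -e ltxx /width -e addNr.
by rewrite -EFinD opprK.
Qed.

End PlanesHitting.

(** * Moments of the inner product of two normals *)

Section PairsOfPlanes.
Variable R : realType.
Notation E3 := 'rV[R]_3.
Variable nu : {finite_measure set (grplane R) -> \bar R}.
Hypothesis nu_inv : rotation_invariant nu.
Hypothesis nu_mass : nu [set: grplane R] = (2 * pi)%:E.
Let nuoo := nu_setT_lty nu_mass.
Notation nu2 := (nu \x nu)%E.

Definition pair_dot (PQ : grplane R * grplane R) : R :=
  dot (plane_normal PQ.1) (plane_normal PQ.2).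

Lemma bounded_pair_dot : bounded_mfun pair_dot.
Proof.
split.
  by apply: measurable_dot; exact: (measurableT_comp (@measurable_normal R)).
exists 1 => -[P Q]; apply: sphere2_dot_le1.
  by have [] := normal_grplane P.
by have [] := normal_grplane Q.
Qed.

Lemma bounded_mfun_fst (f : grplane R -> R) :
  bounded_mfun f -> bounded_mfun (fun PQ : grplane R * grplane R => f PQ.1).
Proof.
by move=> [mf [M fM]]; split; [exact: (measurableT_comp mf)|exists M => PQ].
Qed.

Lemma bounded_mfun_snd (f : grplane R -> R) :
  bounded_mfun f -> bounded_mfun (fun PQ : grplane R * grplane R => f PQ.2).
Proof.
by move=> [mf [M fM]]; split; [exact: (measurableT_comp mf)|exists M => PQ].
Qed.

Lemma nu2_setT_lty : (nu2 setT < +oo)%E.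
Proof.
by rewrite -setXTT product_measure1E// [X in (X * X)%E](_ : _ = (2 * pi)%:E) ?ltry.
Qed.

(** By Tonelli, the integral over the second normal is a zonal moment about the first, whose value
    does not depend on the direction. *)
Lemma zonal_average_fst k (f : grplane R -> R) :
  bounded_mfun f -> (forall P, 0 <= f P) ->
  \int[nu2]_PQ (pair_dot PQ ^+ (2 * k) * f PQ.1) =
  2 * pi / (2 * k + 1)%:R * \int[nu]_P f P.
Proof.
move=> bf f0; have bpf := bounded_mfunM (bounded_mfunX (2 * k) bounded_pair_dot)
  (bounded_mfun_fst bf).
apply: EFin_inj; rewrite -bounded_integralE//; last exact: nu2_setT_lty.
rewrite fubini_tonelli1; last 2 first.
- by apply/measurable_EFinP; case: bpf.
- by move=> PQ; rewrite lee_fin mulr_ge0// exprM exprn_ge0// sqr_ge0.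
rewrite -bounded_RintegralZ// -bounded_integralE//; last exact: bounded_mfunZ.
apply: eq_integral => P _; rewrite /fubini_F /pair_dot /=.
have [nS _] := normal_grplane P.
rewrite bounded_integralE//; last first.
  exact/bounded_mfunM/bounded_mfun_cst/bounded_mfunX/bounded_dot_normal.
under eq_Rintegral do rewrite mulrC.
rewrite bounded_RintegralZ// 1?mulrC; last exact/bounded_mfunX/bounded_dot_normal.
by rewrite -(zonal_momentE nu_inv nu_mass k nS).
Qed.

Lemma zonal_average_snd k (f : grplane R -> R) :
  bounded_mfun f -> (forall P, 0 <= f P) ->
  \int[nu2]_PQ (pair_dot PQ ^+ (2 * k) * f PQ.2) =
  2 * pi / (2 * k + 1)%:R * \int[nu]_P f P.
Proof.
move=> bf f0; rewrite -(zonal_average_fst k bf f0).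
have bpf1 := bounded_mfunM (bounded_mfunX (2 * k) bounded_pair_dot) (bounded_mfun_fst bf).
have bpf2 := bounded_mfunM (bounded_mfunX (2 * k) bounded_pair_dot) (bounded_mfun_snd bf).
have p0 PQ : 0 <= pair_dot PQ ^+ (2 * k) by rewrite exprM exprn_ge0// sqr_ge0.
apply: EFin_inj; rewrite -!bounded_integralE//; try exact: nu2_setT_lty.
rewrite fubini_tonelli1; last 2 first.
- by apply/measurable_EFinP; case: bpf2.
- by move=> PQ; rewrite lee_fin mulr_ge0.
rewrite fubini_tonelli1; last 2 first.
- by apply/measurable_EFinP; case: bpf1.
- by move=> PQ; rewrite lee_fin mulr_ge0.
rewrite /fubini_F.
(* Exchanging the order of integration moves [f] to the outer variable; symmetry of the inner
   product then identifies the two sides. *)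
rewrite [LHS](@fubini_tonelli _ _ _ _ _ nu nu
  (fun PQ => (pair_dot PQ ^+ (2 * k) * f PQ.2)%:E)); last 2 first.
- by apply/measurable_EFinP; case: bpf2.
- by move=> PQ; rewrite lee_fin mulr_ge0.
by apply: eq_integral => P _; apply: eq_integral => Q _; rewrite /pair_dot /= dotC.
Qed.

Variable K : set E3.
Hypothesis K0 : K !=set0.
Hypothesis K_compact : compact K.
Hypothesis K_convex : convex_set (K : set (convex_lmodType E3)).

Definition normal_width (P : grplane R) := width K (plane_normal P).
Notation w := normal_width.

Lemma bounded_normal_width : bounded_mfun w.
Proof.
have mp := measurable_support K0 K_compact.
split; last first.
  have [M wM] := width_bounded K0 K_compact; exists M => P; apply: wM.
  by have [] := normal_grplane P.
apply: (measurableT_comp (f := width K : borel3 R -> R)); last exact: measurable_normal.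
apply: measurable_funD => //.
by apply: (measurableT_comp mp); exact: borel3_opp_measurable.
Qed.

Lemma normal_width_ge0 P : 0 <= w P.
Proof. exact: width_ge0. Qed.

Definition normals_dot (EE : affplane R * affplane R) : R :=
  dot (plane_normal EE.1) (plane_normal EE.2).

Lemma measurable_normals_dot : measurable_fun setT normals_dot.
Proof.
by apply: measurable_dot; exact: (measurableT_comp (@measurable_aff_normal R)).
Qed.

Notation mu2 := (plane_measure nu \x plane_measure nu)%E.
Notation H := (hits K `*` hits K).

Lemma measurable_hits2 : measurable H.
Proof. by apply: measurableX; exact: measurable_hits. Qed.

(** [integral_hits] is applied twice, first to the second plane with the first one fixed, then to
    the resulting function of the first normal. *)
Lemma ge0_integral_hits2 (g : R -> \bar R) :
  measurable_fun setT g -> (forall x, (0 <= g x)%E) ->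
  (\int[mu2]_(EE in H) g (normals_dot EE) =
   \int[nu2]_PQ (g (pair_dot PQ) * (w PQ.1 * w PQ.2)%:E))%E.
Proof.
move=> mg g0; have mH := measurable_hits K0 K_compact K_convex.
(* The inner integral is defined at every vector, not only at normals, because [integral_hits] takes
   measurable functions on the whole space. *)
pose h u := (\int[nu]_Q (g (dot u (plane_normal Q)) * (w Q)%:E))%E.
have hw0 u (Q : grplane R) : (0 <= g (dot u (plane_normal Q)) * (w Q)%:E)%E.
  by rewrite mule_ge0// lee_fin normal_width_ge0.
have mh : measurable_fun setT (h : borel3 R -> \bar R).
  apply: (@measurable_fun_fubini_tonelli_F _ _ (borel3 R) (grplane R) R nu
    (fun uQ : borel3 R * grplane R => g (dot (uQ.1 : E3) (plane_normal uQ.2)) * (w uQ.2)%:E)%E).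
    apply: emeasurable_funM.
      apply: (measurableT_comp mg).
      by apply: measurable_dot => //; exact: (measurableT_comp (@measurable_normal R)).
    by apply/measurable_EFinP; apply: (measurableT_comp bounded_normal_width.1).
  by move=> [u Q]; exact: hw0.
have mr : measurable_fun setT ((fun EE => g (normals_dot EE)) \_ H).
  apply/(measurable_restrictT _ measurable_hits2); apply: measurable_funTS.
  exact: (measurableT_comp mg measurable_normals_dot).
have r0 EE : (0 <= ((fun EE => g (normals_dot EE)) \_ H) EE)%E.
  by apply: erestrict_ge0 => ? _.
rewrite [LHS]integral_mkcond (fubini_tonelli1 _ mr r0).
transitivity (\int[plane_measure nu]_(E in hits K) h (plane_normal E))%E.
  rewrite [RHS]integral_mkcond; apply: eq_integral => E _; rewrite /fubini_F /patch.
  case: ifPn => EK.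
    rewrite /h -(@integral_hits R nu K K0 K_compact K_convex
      (fun v => g (dot (plane_normal E) v))); last 2 first.
    - apply: (measurableT_comp mg).
      by apply: (@measurable_dot _ _ (borel3 R)).
    - by [].
    rewrite [RHS]integral_mkcond; apply: eq_integral => F _; rewrite /patch in_setX EK.
    by [].
  by under eq_integral do rewrite in_setX (negbTE EK)/=; rewrite integral0.
rewrite integral_hits//; last by move=> u; exact: integral_ge0.
rewrite fubini_tonelli1; last 2 first.
- apply: emeasurable_funM; first exact: (measurableT_comp mg bounded_pair_dot.1).
  apply/measurable_EFinP; apply: measurable_funM.
    exact: (bounded_mfun_fst bounded_normal_width).1.
  exact: (bounded_mfun_snd bounded_normal_width).1.
- by move=> PQ; rewrite mule_ge0// lee_fin mulr_ge0// normal_width_ge0.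
apply: eq_integral => P _; rewrite /fubini_F /pair_dot /=.
rewrite muleC -ge0_integralZl//; last 2 first.
- apply: emeasurable_funM; last by apply/measurable_EFinP; case: bounded_normal_width.
  exact: (measurableT_comp mg (measurable_dot_normal _)).
- by rewrite lee_fin normal_width_ge0.
by apply: eq_integral => Q _; rewrite EFinM muleCA.
Qed.

Definition width_moment k :=
  \int[nu2]_PQ (pair_dot PQ ^+ (2 * k) * (w PQ.1 * w PQ.2)).

Lemma bounded_width_moment k :
  bounded_mfun (fun PQ => pair_dot PQ ^+ (2 * k) * (w PQ.1 * w PQ.2)).
Proof.
apply: bounded_mfunM; first exact: bounded_mfunX bounded_pair_dot.
apply: bounded_mfunM; first exact: bounded_mfun_fst bounded_normal_width.
exact: bounded_mfun_snd bounded_normal_width.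
Qed.

Lemma integral_hits2_expr k :
  (\int[mu2]_(EE in H) (normals_dot EE ^+ (2 * k))%:E = (width_moment k)%:E)%E.
Proof.
rewrite /width_moment -bounded_integralE; last 2 first.
- exact: nu2_setT_lty.
- exact: bounded_width_moment.
transitivity (\int[mu2]_(EE in H) (`|normals_dot EE| ^+ (2 * k))%:E)%E.
  by apply: eq_integral => EE _; rewrite -normrX ger0_norm// exprM exprn_ge0// sqr_ge0.
rewrite (@ge0_integral_hits2 (fun x => (`|x| ^+ (2 * k))%:E)).
- apply: eq_integral => PQ _; rewrite -EFinM; congr (_ * _)%:E.
  by rewrite -normrX ger0_norm// exprM exprn_ge0// sqr_ge0.
- by apply/measurable_EFinP; apply: measurable_funX; exact: normr_measurable.
- by move=> x; rewrite lee_fin exprn_ge0.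
Qed.

(** This mass is the moment of order zero. *)
Lemma mu2_hits2_lty : (mu2 H < +oo)%E.
Proof.
have := integral_hits2_expr 0; under eq_integral do rewrite muln0 expr0.
by rewrite integral_cst; [rewrite mul1e => ->; exact: ltry|exact: measurable_hits2].
Qed.

End PairsOfPlanes.

(** * Legendre polynomials *)

Section LegendreMoments.
Variable R : realType.
Implicit Types (p q : {poly R}).

(** Through Rodrigues' formula these facts give the degree, the nonzero leading coefficient and the
    parity of the even Legendre polynomials. *)
Lemma coef_X2_sub1_exp m :
  [/\ forall j, (2 * m < j)%N -> (('X^2 - 1) ^+ m : {poly R})`_j = 0,
      (('X^2 - 1) ^+ m : {poly R})`_(2 * m) = 1
    & forall j, odd j -> (('X^2 - 1) ^+ m : {poly R})`_j = 0].
Proof.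
elim: m => [|m [IH1 IH2 IH3]].
  by rewrite expr0 muln0; split=> [[]//||[]//]; rewrite // => *; rewrite coef1.
have cE j : (('X^2 - 1) ^+ m.+1 : {poly R})`_j =
    (if (j < 2)%N then 0 else (('X^2 - 1) ^+ m : {poly R})`_(j - 2))
    - (('X^2 - 1) ^+ m : {poly R})`_j.
  by rewrite exprS mulrBl mul1r coefB coefXnM.
split=> [j mj||j oj]; rewrite cE.
- rewrite ltnNge (_ : (1 < j)%N)/=; last lia.
  by rewrite !IH1 ?subr0//; lia.
- rewrite ltnNge (_ : (1 < 2 * m.+1)%N)/=; last lia.
  rewrite (IH1 (2 * m.+1)%N); last lia.
  by rewrite (_ : (2 * m.+1 - 2)%N = (2 * m)%N) ?IH2 ?subr0//; lia.
- rewrite (IH3 j oj) subr0; case: ifP => // j2; apply: IH3.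
  by rewrite oddB ?oj//; lia.
Qed.

Lemma legendre_coef n i :
  (legendre R n)`_i =
  ((2 ^ n * n`!)%:R)^-1 * ((('X^2 - 1) ^+ n : {poly R})`_(n + i) *+ (n + i) ^_ n).
Proof. by rewrite /legendre coefZ coef_derivn. Qed.

(** Induction on k: the Legendre polynomial of degree 2(k + 1) is even with nonzero leading
    coefficient, so the top monomial is a combination of it and of lower even powers, on all of
    which [D] vanishes. *)
Lemma even_legendre_functional (D : {poly R} -> R) :
  (forall p q, D (p + q) = D p + D q) -> (forall a p, D (a *: p) = a * D p) ->
  D 1 = 0 -> (forall n, (1 <= n)%N -> D (legendre R (2 * n)) = 0) ->
  forall k, D 'X^(2 * k) = 0.
Proof.
move=> DD DZ D1 DL; elim/ltn_ind => -[|k] IH; first by rewrite muln0 expr0.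
set m := (2 * k.+1)%N; pose P := legendre R m.
have D0 : D 0 = 0 by rewrite -(scale0r 0) DZ mul0r.
have Dsum n (F : nat -> {poly R}) : D (\sum_(i < n) F i) = \sum_(i < n) D (F i).
  by elim: n => [|n IHn]; rewrite ?big_ord0// !big_ord_recr/= DD IHn.
have [c1 c2 c3] := coef_X2_sub1_exp m.
have P_top i : (m < i)%N -> P`_i = 0.
  by move=> mi; rewrite legendre_coef c1 ?mul0rn ?mulr0//; lia.
have P_odd i : odd i -> P`_i = 0.
  by move=> oi; rewrite legendre_coef c3 ?mul0rn ?mulr0// oddD oi /m oddM.
have P_m : P`_m != 0.
  rewrite legendre_coef addnn -mul2n c2 mulf_neq0// ?invr_neq0 ?pnatr_eq0//.
  by rewrite -lt0n ffact_gt0; lia.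
have PE : P = \sum_(i < m.+1) P`_i *: 'X^i.
  rewrite -poly_def; apply/polyP => i; rewrite coef_poly.
  by case: ltnP => // mi; rewrite P_top.
have := DL k.+1 isT; rewrite -/m -/P PE (Dsum _ (fun i => P`_i *: 'X^i)).
rewrite big_ord_recr/= big1 ?add0r => [|i _].
  by rewrite DZ => /eqP; rewrite mulf_eq0 (negbTE P_m) => /eqP.
rewrite DZ; case oi: (odd i); first by rewrite P_odd// mul0r.
have -> : (i : nat) = (2 * i./2)%N by rewrite mul2n -[LHS]odd_double_half oi.
by rewrite IH ?mulr0//; have := ltn_ord i; rewrite /m; have := odd_double_half i; lia.
Qed.

Lemma Rintegral_deriv p :
  \int[lebesgue_measure]_(t in `[(-1)%R, 1%R]) p^`().[t] = p.[1] - p.[-1].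
Proof.
have N11 : -1 < 1 :> R by lra.
rewrite /Rintegral (@continuous_FTC2 _ _ (horner p))//.
- by apply: continuous_subspaceT => x; exact: continuous_horner.
- split=> [x _| |]; first exact: derivable_horner.
  + by apply: cvg_at_right_filter; exact: continuous_horner.
  + by apply: cvg_at_left_filter; exact: continuous_horner.
- by move=> x _; rewrite derivE.
Qed.

Lemma Rintegral_X2k k :
  \int[lebesgue_measure]_(t in `[(-1)%R, 1%R]) (t ^+ (2 * k)) = 2 / (2 * k + 1)%:R :> R.
Proof.
have k1 : (2 * k + 1)%:R != 0 :> R by rewrite pnatr_eq0 addn1.
transitivity (\int[lebesgue_measure]_(t in `[(-1)%R, 1%R])
    ((2 * k + 1)%:R^-1 *: 'X^(2 * k + 1) : {poly R})^`().[t]).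
  apply: eq_Rintegral => t _; rewrite derivZ derivXn addn1 /= hornerZ hornerMn hornerXn.
  by rewrite -(mulr_natl (t ^+ _)) mulrA -addn1 mulVf ?mul1r.
rewrite Rintegral_deriv !hornerZ !hornerXn expr1n -signr_odd oddD oddM/= expr1.
by field.
Qed.

(** Each derivative lowers the multiplicity of the roots 1 and -1 by at most one. *)
Lemma derivn_X2_sub1_exp m j : (j <= m)%N ->
  exists r : {poly R}, (('X^2 - 1) ^+ m)^`(j) = ('X^2 - 1) ^+ (m - j) * r.
Proof.
elim: j => [|j IH] jm; first by exists 1; rewrite derivn0 subn0 mulr1.
have [r rE] := IH (ltnW jm).
exists ((m - j)%:R * ('X^2 - 1)^`() * r + ('X^2 - 1) * r^`()).
rewrite derivnS rE derivM deriv_exp -(subnSK jm) /= (exprS _ (m - j.+1)) -mulr_natl.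
have ringE (c A P B r1 r2 : {poly R}) :
  c * (B * P) * r1 + A * P * r2 = P * (c * B * r1 + A * r2) by ring.
exact: ringE.
Qed.

(** Up to a factor the polynomial is the derivative of the (n - 1)-st derivative of (X^2 - 1)^n,
    which still vanishes at 1 and -1. *)
Lemma Rintegral_legendre n : (1 <= n)%N ->
  \int[lebesgue_measure]_(t in `[(-1)%R, 1%R]) (legendre R n).[t] = 0.
Proof.
move=> n1; set c := ((2 ^ n * n`!)%:R)^-1 : R.
have [r rE] := derivn_X2_sub1_exp (leq_pred n).
transitivity (\int[lebesgue_measure]_(t in `[(-1)%R, 1%R])
    (c *: (('X^2 - 1) ^+ n)^`(n.-1) : {poly R})^`().[t]).
  by apply: eq_Rintegral => t _; rewrite derivZ -derivnS prednK.
rewrite Rintegral_deriv !hornerZ rE (_ : (n - n.-1)%N = 1%N); last by lia.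
have h1 : ('X^2 - 1 : {poly R}).[1] = 0 by rewrite !hornerE; ring.
have hN1 : ('X^2 - 1 : {poly R}).[-1] = 0 by rewrite !hornerE; ring.
by rewrite expr1 !hornerM h1 hN1 !mul0r subrr.
Qed.

End LegendreMoments.

(** Extends the scaling rule from nonnegative functions by splitting into positive and negative
    parts; integrability keeps their difference well defined. *)
Lemma integrable_integral_mscale d (T : measurableType d) (R : realType)
    (m : {measure set T -> \bar R}) (D : set T) (k : {nonneg R}) (f : T -> \bar R) :
  measurable D -> m.-integrable D f ->
  (\int[mscale k m]_(x in D) f x = k%:num%:E * \int[m]_(x in D) f x)%E.
Proof.
move=> mD fi; have mf := measurable_int m fi.
have fp := integrable_funepos mD fi; have fn := integrable_funeneg mD fi.
transitivity (\int[mscale k m]_(x in D) f^\+ x - \int[mscale k m]_(x in D) f^\- x)%E.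
  exact: integralE.
rewrite !ge0_integral_mscale//; last 2 first.
- exact: measurable_funeneg.
- exact: measurable_funepos.
rewrite -muleBr//; last by rewrite fin_num_adde_defr// integrable_fin_num.
by congr (_ * _)%E; rewrite -integralE.
Qed.

(** * Mean width of a body of constant width *)

Section MeanWidth.
Variable R : realType.
Notation E3 := 'rV[R]_3.

Lemma sphere2_point (theta phi : R) : sphere2 (sphere_point theta phi).
Proof.
rewrite /sphere2 /= dotE /sphere_point /vec3 !mxE !inordK//=.
have c (x : R) : cos x * cos x = 1 - sin x * sin x.
  by have := cos2Dsin2 x; rewrite !expr2 => <-; rewrite addrK.
set s := sin theta; have -> : s * cos phi * (s * cos phi) = s * s * (cos phi * cos phi).
  by ring.
by rewrite !c -/s; ring.
Qed.

Lemma Rintegral_sin_0pi : \int[lebesgue_measure]_(x in `[0%R, pi]) sin x = 2 :> R.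
Proof.
rewrite /Rintegral (@continuous_FTC2 _ _ (fun x => - cos x)).
- by rewrite /= cospi cos0 opprK; ring.
- exact: pi_gt0.
- by apply: continuous_subspaceT => x; exact: continuous_sin.
- split=> [x _| |].
  + by apply: derivableN; exact: derivable_cos.
  + by apply: cvgN; apply: cvg_at_right_filter; exact: continuous_cos.
  + by apply: cvgN; apply: cvg_at_left_filter; exact: continuous_cos.
- move=> x _; rewrite derive1E deriveN//.
  by rewrite derive_val opprK.
Qed.

Lemma mean_width_cst (K : set E3) (W : R) :
  (forall u, sphere2 u -> width K u = W) -> mean_width K = W.
Proof.
move=> KW; rewrite /mean_width /sphere_integral.
have inner phi : \int[lebesgue_measure]_(theta in `[0%R, pi])
    (width K (sphere_point theta phi) * sin theta) = W * 2.
  rewrite -Rintegral_sin_0pi -RintegralZl//; last first.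
    apply: continuous_compact_integrable; first exact: segment_compact.
    by apply: continuous_subspaceT => x; exact: continuous_sin.
  by apply: eq_Rintegral => theta _; rewrite KW//; exact: sphere2_point.
under eq_Rintegral do rewrite inner.
have lm : lebesgue_measure (`[0%R, (2 * pi)%R]%classic : set R) = (2 * pi)%:E.
  by rewrite lebesgue_measure_itv/= lte_fin mulr_gt0 ?pi_gt0// -EFinB subr0.
rewrite Rintegral_cst// [X in fine X](_ : _ = (2 * pi)%:E) //=.
have p0 : pi != 0 :> R by rewrite gt_eqF ?pi_gt0.
by move: (pi : R) p0 => p p0; field.
Qed.

End MeanWidth.

(** * Constant width implies the identity *)

Section ConstantWidth.
Variable R : realType.
Notation E3 := 'rV[R]_3.
Variable nu : {finite_measure set (grplane R) -> \bar R}.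
Hypothesis nu_inv : rotation_invariant nu.
Hypothesis nu_mass : nu [set: grplane R] = (2 * pi)%:E.
Variable K : set E3.
Hypothesis K0 : K !=set0.
Hypothesis K_compact : compact K.
Hypothesis K_convex : convex_set (K : set (convex_lmodType E3)).
Notation mu2 := (plane_measure nu \x plane_measure nu)%E.
Notation H := (hits K `*` hits K).
Notation I01 := (`[0%R, 1%R]%classic : set R).
Notation N11 := (`[(-1)%R, 1%R]%classic : set R).

Lemma width_moment_cst (W : R) k : (forall u, sphere2 u -> width K u = W) ->
  width_moment nu K k = (2 * pi * W) ^+ 2 / (2 * k + 1)%:R.
Proof.
move=> KW.
have wE P : normal_width K P = W.
  by rewrite /normal_width KW//; have [] := normal_grplane P.
have b1 : bounded_mfun (cst 1 : grplane R -> R) by exact: bounded_mfun_cst.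
have bp := bounded_mfunX (2 * k) (@bounded_pair_dot R).
rewrite /width_moment; under eq_Rintegral do rewrite !wE mulrC.
rewrite (bounded_RintegralZ (nu2_setT_lty nu_mass))//.
have := zonal_average_fst nu_inv nu_mass k b1 (fun=> ler01).
under eq_Rintegral do rewrite mulr1.
move=> ->; rewrite Rintegral_cst// [X in fine X](_ : _ = (2 * pi)%:E) //=.
by ring.
Qed.

(* The value [-1] away from the pairs that hit [K] makes these pairs the preimage
   of [0, 1]. *)
Definition hits_dot2 (EE : affplane R * affplane R) : R :=
  ((fun EE => normals_dot EE ^+ 2 + 1) \_ H) EE - 1.

Lemma hits_dot2E EE : H EE -> hits_dot2 EE = normals_dot EE ^+ 2.
Proof. by move=> HEE; rewrite /hits_dot2 patchE mem_set// addrK. Qed.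

Lemma normals_dot_itv (EE : affplane R * affplane R) : -1 <= normals_dot EE <= 1.
Proof.
rewrite -ler_norml; case: EE => E F; apply: sphere2_dot_le1.
  have [u [t [uS Eu]]] := aff_setP E; rewrite /= Eu normal_hplane//.
  by case: ifP; rewrite ?sphere2N.
have [u [t [uS Eu]]] := aff_setP F; rewrite /= Eu normal_hplane//.
by case: ifP; rewrite ?sphere2N.
Qed.

Lemma normals_dot2_itv (EE : affplane R * affplane R) : I01 (normals_dot EE ^+ 2).
Proof.
rewrite /= in_itv/= sqr_ge0/= -[leRHS](expr1n _ 2) -normr1.
rewrite -[leLHS]real_normK ?num_real// ler_sqr ?nnegrE//.
by rewrite normr1 ler_norml normals_dot_itv.
Qed.

Lemma preimage_hits_dot2 : hits_dot2 @^-1` I01 = H.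
Proof.
apply/seteqP; split=> EE; last first.
  by move=> h; rewrite /preimage /= hits_dot2E//; exact: normals_dot2_itv.
rewrite /preimage /= /hits_dot2 patchE; case: ifPn; first by rewrite inE.
by rewrite /point /= sub0r in_itv/= oppr_ge0 ler10.
Qed.

Lemma measurable_hits_dot2 : measurable_fun setT hits_dot2.
Proof.
apply: measurable_funB => //.
apply/(measurable_restrictT _ (measurable_hits2 K0 K_compact K_convex)).
apply: measurable_funTS; apply: measurable_funD => //.
by apply: measurable_funX; exact: measurable_normals_dot.
Qed.

Lemma hits_dot2_moment k :
  \int[mu2]_(EE in H) (hits_dot2 EE ^+ k) = width_moment nu K k.
Proof.
rewrite /Rintegral (eq_integral (fun EE => (normals_dot EE ^+ (2 * k))%:E)).
  by rewrite (integral_hits2_expr nu_mass K0 K_compact K_convex).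
by move=> EE; rewrite inE => HEE; rewrite hits_dot2E// exprM.
Qed.

Lemma preimage_sqr01 : (fun t : R => t ^+ 2) @^-1` I01 = N11.
Proof.
apply/seteqP; split=> t /=; rewrite !in_itv/= sqr_ge0/= -ler_norml;
  by rewrite -[t ^+ 2]real_normK ?num_real// expr_le1.
Qed.

(** The law of X on [0, 1] has the moments of t^2 under c times Lebesgue measure on [-1, 1], and an
    even [f] is the function f(sqrt x) of x = t^2. Extending [f] by 0 outside [-1, 1] makes this
    function measurable on the whole line. *)
Lemma integral_sqr_law d (T : measurableType d) (m : {measure set T -> \bar R})
    (X : T -> R) (c : R) (f : R -> R) (M : R) :
  measurable_fun setT X -> (m (X @^-1` I01) < +oo)%E -> 0 <= c ->
  (forall k, \int[m]_(x in X @^-1` I01) (X x ^+ k) = c * (2 / (2 * k + 1)%:R)) ->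
  (forall t, -1 <= t <= 1 -> f (- t) = f t) ->
  (forall t, -1 <= t <= 1 -> `|f t| <= M) ->
  measurable_fun N11 f ->
  (\int[m]_(x in X @^-1` I01) ((f \_ N11) (Num.sqrt (X x)))%:E =
   (c * \int[lebesgue_measure]_(t in N11) f t)%:E)%E.
Proof.
move=> mX moo c0 mom fE fM mf.
pose sq := fun t : R => t ^+ 2.
have msq : measurable_fun setT sq by exact: measurable_funX.
have mg : measurable_fun setT (fun x : R => (f \_ N11) (Num.sqrt x)).
  apply: (measurableT_comp (f := f \_ N11)).
    exact: (iffLR (measurable_restrictT f (measurable_itv _)) mf).
  by apply: continuous_measurable_fun; exact: sqrt_continuous.
have gM x : I01 x -> `|(f \_ N11) (Num.sqrt x)| <= M.
  rewrite /= in_itv/= => /andP[x0 x1].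
  have sx : 0 <= Num.sqrt x <= 1 by rewrite sqrtr_ge0/= -sqrtr1 ler_wsqrtr.
  have t1 : -1 <= Num.sqrt x <= 1 by move: sx => /andP[s0 ->]; rewrite andbT; lra.
  by rewrite patchE mem_set ?fM//= in_itv.
have N11oo : (lebesgue_measure N11 < +oo)%E.
  by rewrite lebesgue_measure_itv/=; case: ifP => _; rewrite ltry.
have fi : lebesgue_measure.-integrable N11 (EFin \o f).
  by apply: (@integrable_bounded _ _ _ _ _ _ M) => // t; rewrite /= in_itv/=; exact: fM.
(* The root of t^2 is |t|, and evenness leads back to t. *)
have gE t : N11 t -> (f \_ N11) (Num.sqrt (sq t)) = f t.
  rewrite /= in_itv/= => t1; rewrite sqrtr_sqr patchE mem_set; last first.
    by rewrite /= in_itv/=; move: t1; rewrite -!ler_norml normr_id.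
  by have [t0|t0] := ger0P t; rewrite ?fE.
have ik k : lebesgue_measure.-integrable N11 (EFin \o (fun t => sq t ^+ k)).
  apply: (@integrable_bounded _ _ _ _ _ _ 1) => //.
    by apply: measurable_funTS; apply: measurable_funX.
  move=> t; rewrite /= in_itv/= -ler_norml => t1.
  by rewrite /sq -exprM normrX exprn_ile1.
have sqI : sq @^-1` I01 = N11 := preimage_sqr01.
have main := @eq_moments_map R _ _ _ _ m (mscale (NngNum c0) (@lebesgue_measure R))
  _ _ _ _ mX msq mg gM moo.
rewrite main; last 2 first.
- by rewrite sqI /= /mscale/= lte_mul_pinfty.
- move=> k; rewrite mom sqI /Rintegral integrable_integral_mscale//; last exact: ik.
  rewrite fineM//; last by exact: (integrable_fin_num _ (ik k)).
  congr (_ * _); rewrite -Rintegral_X2k.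
  by apply: eq_Rintegral => t _; rewrite /sq exprM.
rewrite sqI; transitivity
  (\int[mscale (NngNum c0) (@lebesgue_measure R)]_(t in N11) (f t)%:E)%E.
  by apply: eq_integral => t; rewrite inE => t1; rewrite gE.
rewrite integrable_integral_mscale// -[X in (_ * X)%E]fineK//.
exact: (integrable_fin_num _ fi).
Qed.

Lemma pair_integral_cst (W : R) (f : R -> R) :
  (forall u, sphere2 u -> width K u = W) ->
  (forall t : R, -1 <= t <= 1 -> f (- t) = f t) ->
  (exists M : R, forall t : R, -1 <= t <= 1 -> `|f t| <= M) ->
  measurable_fun N11 f ->
  pair_integral nu K f = (lambda0 f * pi * W ^+ 2)%:E.
Proof.
move=> KW fE [M fM] mf.
(* This factor c is fixed by (2 pi W)^2 / (2k + 1) = c * 2 / (2k + 1), where 2 / (2k + 1) is the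
   integral of t^(2k) over [-1, 1]. *)
have c0 : 0 <= 2 * pi ^+ 2 * W ^+ 2.
  by apply: mulr_ge0; [apply: mulr_ge0 => //|]; exact: sqr_ge0.
have Hoo : (mu2 (hits_dot2 @^-1` I01) < +oo)%E.
  by rewrite preimage_hits_dot2; exact: (mu2_hits2_lty nu_mass).
have mom k : \int[mu2]_(EE in hits_dot2 @^-1` I01) (hits_dot2 EE ^+ k) =
    2 * pi ^+ 2 * W ^+ 2 * (2 / (2 * k + 1)%:R).
  by rewrite preimage_hits_dot2 hits_dot2_moment (width_moment_cst _ KW); ring.
have := integral_sqr_law measurable_hits_dot2 Hoo c0 mom fE fM mf.
rewrite preimage_hits_dot2 => h; rewrite /pair_integral.
transitivity (\int[mu2]_(EE in H) ((f \_ N11) (Num.sqrt (hits_dot2 EE)))%:E)%E.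
  apply: eq_integral => EE; rewrite inE => HEE; have t1 := normals_dot_itv EE.
  rewrite hits_dot2E// sqrtr_sqr patchE mem_set; last first.
    by rewrite /= in_itv/=; move: t1; rewrite -!ler_norml normr_id.
  rewrite -/(normals_dot EE).
  by have [t0|t0] := ger0P (normals_dot EE); rewrite ?fE.
by rewrite h /lambda0; congr EFin; ring.
Qed.

End ConstantWidth.

(** * The identity implies constant width *)

Section Converse.
Variable R : realType.
Notation E3 := 'rV[R]_3.
Variable nu : {finite_measure set (grplane R) -> \bar R}.
Hypothesis nu_inv : rotation_invariant nu.
Hypothesis nu_mass : nu [set: grplane R] = (2 * pi)%:E.
Variable K : set E3.
Hypothesis K0 : K !=set0.
Hypothesis K_compact : compact K.
Hypothesis K_convex : convex_set (K : set (convex_lmodType E3)).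
Notation mu2 := (plane_measure nu \x plane_measure nu)%E.
Notation nu2 := (nu \x nu)%E.
Notation H := (hits K `*` hits K).
Notation N11 := (`[(-1)%R, 1%R]%classic : set R).
Notation w := (normal_width K).

(** For a Legendre polynomial of positive even degree, the integral over [-1, 1] is zero, hence so
    is [lambda0], and the identity makes the integral over pairs of planes vanish too. The two
    functionals are thus proportional on even powers. *)
Lemma width_moment_legendre :
  (forall n, (1 <= n)%N ->
     mean_width_identity nu K (fun t => (legendre R (2 * n)).[t])) ->
  forall k, width_moment nu K k = width_moment nu K 0 / (2 * k + 1)%:R.
Proof.
move=> hyp k.
have mH := measurable_hits2 K0 K_compact K_convex.
have Hoo := mu2_hits2_lty nu_mass K0 K_compact K_convex.
have N11oo : (lebesgue_measure N11 < +oo)%E.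
  by rewrite lebesgue_measure_itv/=; case: ifP => _; rewrite ltry.
pose L (p : {poly R}) := \int[mu2]_(EE in H) p.[normals_dot EE].
pose I (p : {poly R}) := \int[lebesgue_measure]_(t in N11) p.[t].
have iL p : mu2.-integrable H (EFin \o (fun EE => p.[normals_dot EE])).
  apply: integrable_horner => //; first exact: measurable_normals_dot.
  by move=> EE _; rewrite ler_norml normals_dot_itv.
have iI p : lebesgue_measure.-integrable N11 (EFin \o horner p).
  have [M pM] := horner_bounded p.
  apply: (@integrable_bounded _ _ _ _ _ _ M) => // [|t].
    exact: measurable_horner.
  by rewrite /= in_itv/= -ler_norml; exact: pM.
have LX j : L 'X^(2 * j) = width_moment nu K j.
  rewrite /L /Rintegral; under eq_integral do rewrite hornerXn.
  by rewrite (integral_hits2_expr nu_mass K0 K_compact K_convex).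
have IX j : I 'X^(2 * j) = 2 / (2 * j + 1)%:R.
  by rewrite /I; under eq_Rintegral do rewrite hornerXn; rewrite Rintegral_X2k.
pose J0 := width_moment nu K 0.
(* The factor [J0 / 2] is chosen so that D 1 = 0, the integral of 1 over [-1, 1] being 2. *)
pose D p := L p - J0 / 2 * I p.
have /(_ k) : forall k, D 'X^(2 * k) = 0.
  apply: even_legendre_functional => [p q|a p||n n1].
  - rewrite /D (_ : L _ = L p + L q); last first.
      by rewrite /L; under eq_Rintegral do rewrite hornerD; rewrite RintegralD.
    rewrite (_ : I _ = I p + I q); first by ring.
    by rewrite /I; under eq_Rintegral do rewrite hornerD; rewrite RintegralD.
  - rewrite /D (_ : L _ = a * L p); last first.
      by rewrite /L; under eq_Rintegral do rewrite hornerZ; rewrite RintegralZl.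
    rewrite (_ : I _ = a * I p); first by ring.
    by rewrite /I; under eq_Rintegral do rewrite hornerZ; rewrite RintegralZl.
  - have := LX 0%N; have := IX 0%N; rewrite muln0 expr0 /D => -> ->.
    by rewrite divr1 divfK ?subrr.
  - have n2 : (1 <= 2 * n)%N by lia.
    rewrite /D /I Rintegral_legendre// mulr0 subr0 /L /Rintegral.
    have := hyp n n1; rewrite /mean_width_identity /pair_integral /lambda0.
    by rewrite Rintegral_legendre// mulr0 !mul0r => ->.
rewrite /D LX IX => /eqP; rewrite subr_eq0 => /eqP ->.
by rewrite mulrA divfK.
Qed.

(** The conclusion of [width_moment_legendre], from which constancy of the width is now derived. *)
Hypothesis J_hyp :
  forall k, width_moment nu K k = width_moment nu K 0 / (2 * k + 1)%:R.

Let A := \int[nu]_P w P.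
Let B := \int[nu]_P (w P ^+ 2).
Let W0 := A / (2 * pi).
Let nuoo := nu_setT_lty nu_mass.
Let nu2oo := nu2_setT_lty nu_mass.
Let bw : bounded_mfun (w : grplane R -> R) := bounded_normal_width K0 K_compact.
Let pi0 : 2 * pi != 0 :> R.
Proof. by rewrite mulf_neq0// gt_eqF ?pi_gt0. Qed.

Lemma width_moment0 : width_moment nu K 0 = A ^+ 2.
Proof.
rewrite /width_moment; under eq_Rintegral do rewrite muln0 expr0 mul1r.
have b12 := bounded_mfunM (bounded_mfun_fst bw) (bounded_mfun_snd bw).
apply: EFin_inj; rewrite -bounded_integralE// fubini_tonelli1; last 2 first.
- by apply/measurable_EFinP; case: b12.
- by move=> PQ; rewrite lee_fin mulr_ge0// normal_width_ge0.
rewrite expr2 -bounded_RintegralZ// -bounded_integralE//; last exact: bounded_mfunZ.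
apply: eq_integral => P _; rewrite /fubini_F /=.
by rewrite bounded_integralE ?bounded_RintegralZ 1?mulrC//; exact: bounded_mfunZ.
Qed.

(** Expanding the square gives two terms w^2, each averaged zonally to B, and a cross term whose
    value is [J_hyp]. *)
Lemma zonal_variance k :
  \int[nu2]_PQ (pair_dot PQ ^+ (2 * k) * (w PQ.1 - w PQ.2) ^+ 2) =
  2 * (2 * pi * B - A ^+ 2) / (2 * k + 1)%:R.
Proof.
have b2 := bounded_mfunX 2 bw.
have bp := bounded_mfunX (2 * k) (@bounded_pair_dot R).
have b1 := bounded_mfunM bp (bounded_mfun_fst b2).
have b3 := bounded_mfunM bp (bounded_mfun_snd b2).
have b12 := bounded_width_moment K0 K_compact k.
have h1 := zonal_average_fst nu_inv nu_mass k b2 (fun P => sqr_ge0 (w P)).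
have h2 := zonal_average_snd nu_inv nu_mass k b2 (fun P => sqr_ge0 (w P)).
transitivity (\int[nu2]_PQ (pair_dot PQ ^+ (2 * k) * w PQ.1 ^+ 2 +
    pair_dot PQ ^+ (2 * k) * w PQ.2 ^+ 2 -
    2 * (pair_dot PQ ^+ (2 * k) * (w PQ.1 * w PQ.2)))).
  by apply: eq_Rintegral => PQ _; move: (_ ^+ (2 * k)) => t; ring.
rewrite bounded_RintegralB//; last 2 first.
- exact: bounded_mfunD.
- exact: bounded_mfunZ.
rewrite bounded_RintegralD// bounded_RintegralZ// h1 h2.
rewrite -/(width_moment nu K k) J_hyp width_moment0 -/B.
by ring.
Qed.

Lemma zonal_average_one k :
  \int[nu2]_PQ (pair_dot PQ ^+ (2 * k)) = (2 * pi) ^+ 2 / (2 * k + 1)%:R.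
Proof.
have := zonal_average_fst nu_inv nu_mass k (@bounded_mfun_cst _ (grplane R) R 1) (fun=> ler01).
under eq_Rintegral do rewrite mulr1.
move=> ->; rewrite Rintegral_cst// [X in fine X](_ : _ = (2 * pi)%:E) //=.
by ring.
Qed.

Lemma le0_of_le_inv (x c : R) :
  (forall k, x <= c / (2 * k + 3)%:R) -> x <= 0.
Proof.
move=> xc; rewrite leNgt; apply/negP => x0.
have k3 k : 0 < (2 * k + 3)%:R :> R by rewrite ltr0n addn3.
(* At this k one has 2k + 3 >= k + 1 > c / x, which contradicts the bound. *)
have := xc (Num.truncn (c / x)); rewrite ler_pdivlMr// => h.
have := truncnS_gt (c / x); rewrite ltr_pdivrMr// => h2.
have : (Num.truncn (c / x)).+1%:R <= (2 * Num.truncn (c / x) + 3)%:R :> R.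
  by rewrite ler_nat; lia.
by move=> h3; have := le_lt_trans h h2; rewrite mulrC ltr_pM2r// ltNge h3.
Qed.

(** Isolates the factor 1 / (2k + 1), which cancels against the other side of the estimates below
    and leaves a bound of order 1 / (2k + 3). *)
Lemma inv_odd_sub (q : R) k :
  q / (2 * k + 1)%:R - q / (2 * k + 3)%:R =
  2 * (q / (2 * k + 3)%:R) / (2 * k + 1)%:R.
Proof.
have -> : (2 * k + 3)%:R = (2 * k + 1)%:R + 2 :> R by rewrite -natrD -addnA.
have : 0 < (2 * k + 1)%:R :> R by rewrite ltr0n addn1.
move: (_%:R) => a a0; field.
by apply/andP; split; rewrite gt_eqF//; lra.
Qed.

Lemma width_variance0 : 2 * pi * B - A ^+ 2 <= 0.
Proof.
have [C C0 wC] := width_lipschitz K0 K_compact.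
apply: (@le0_of_le_inv _ (C * (2 * pi) ^+ 2)) => k.
have bp j := bounded_mfunX (2 * j) (@bounded_pair_dot R).
have k1 : 0 < (2 * k + 1)%:R :> R by rewrite ltr0n addn1.
have bw12 := bounded_mfunX 2 (bounded_mfunB (bounded_mfun_fst bw) (bounded_mfun_snd bw)).
(* The Lipschitz bound brings in the factor 1 - <n1, n2>^2, so the right side is a difference of
   consecutive moments. *)
have : \int[nu2]_PQ (pair_dot PQ ^+ (2 * k) * (w PQ.1 - w PQ.2) ^+ 2) <=
    \int[nu2]_PQ (C * (pair_dot PQ ^+ (2 * k) - pair_dot PQ ^+ (2 * k.+1))).
  apply: bounded_le_Rintegral => //.
  - exact: bounded_mfunM.
  - by apply: bounded_mfunZ; exact: bounded_mfunB.
  move=> -[P Q]; rewrite /pair_dot /=.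
  have [PS _] := normal_grplane P; have [QS _] := normal_grplane Q.
  have := wC _ _ PS QS; set d := dot _ _ => h.
  rewrite (_ : C * _ = d ^+ (2 * k) * (C * (1 - d ^+ 2))).
    by apply: ler_wpM2l => //; rewrite exprM exprn_ge0// sqr_ge0.
  by rewrite mulnS exprD; move: (d ^+ (2 * k)) => t; ring.
rewrite bounded_RintegralZ//; last exact: bounded_mfunB.
rewrite bounded_RintegralB// !zonal_average_one zonal_variance.
rewrite (_ : (2 * k.+1 + 1)%N = (2 * k + 3)%N); last by lia.
rewrite inv_odd_sub; set V := 2 * pi * B - A ^+ 2; set q := (2 * pi) ^+ 2.
rewrite mulrA ler_pM2r ?invr_gt0// mulrCA ler_pM2l// mulrA.
by [].
Qed.

(** Since nu has mass 2 pi and W0 = A / (2 pi), the left side equals (2 pi B - A^2) / (2 pi). *)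
Lemma width_deviation0 : \int[nu]_P ((w P - W0) ^+ 2) <= 0.
Proof.
have b2 := bounded_mfunX 2 bw.
have -> : \int[nu]_P ((w P - W0) ^+ 2) = B - 2 * W0 * A + W0 ^+ 2 * (2 * pi).
  transitivity (\int[nu]_P (w P ^+ 2 - 2 * W0 * w P + W0 ^+ 2)).
    by apply: eq_Rintegral => P _; ring.
  rewrite bounded_RintegralD//; last 2 first.
  - by apply: bounded_mfunB => //; exact: bounded_mfunZ.
  - exact: bounded_mfun_cst.
  rewrite bounded_RintegralB//; last exact: bounded_mfunZ.
  by rewrite bounded_RintegralZ// Rintegral_cst// [X in fine X](_ : _ = (2 * pi)%:E).
have -> : B - 2 * W0 * A + W0 ^+ 2 * (2 * pi) = (2 * pi * B - A ^+ 2) / (2 * pi).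
  by rewrite /W0; move: (2 * pi) pi0 => q q0; field.
by rewrite pmulr_lle0 ?width_variance0// invr_gt0 mulr_gt0 ?pi_gt0.
Qed.

(** The inequality (w(u) - W0)^2 <= 2 (w(u) - w(n))^2 + 2 (w(n) - W0)^2 is integrated with weight
    <u, n>^(2k). The first term is controlled by the Lipschitz bound. In the second the weight is at
    most 1 and the integral is at most 0. Dividing by the moment 2 pi / (2k + 1) leaves 4 C / (2k +
    3), for every single u. *)
Lemma width_eq_mean u : sphere2 u -> width K u = W0.
Proof.
move=> uS; have [C C0 wC] := width_lipschitz K0 K_compact.
suff : (width K u - W0) ^+ 2 <= 0.
  by rewrite le_eqVlt ltNge sqr_ge0 orbF sqrf_eq0 subr_eq0 => /eqP.
have bdu := bounded_dot_normal uS.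
have bd j := bounded_mfunX (2 * j) bdu.
have bW : bounded_mfun (fun P : grplane R => (w P - W0) ^+ 2).
  by apply: bounded_mfunX; apply: bounded_mfunB => //; exact: bounded_mfun_cst.
apply: (@le0_of_le_inv _ (4 * C)) => k.
have k1 : 0 < (2 * k + 1)%:R :> R by rewrite ltr0n addn1.
have : \int[nu]_P ((width K u - W0) ^+ 2 * dot u (plane_normal P) ^+ (2 * k)) <=
    \int[nu]_P (2 * C * (dot u (plane_normal P) ^+ (2 * k)
       - dot u (plane_normal P) ^+ (2 * k.+1)) + 2 * (w P - W0) ^+ 2).
  apply: bounded_le_Rintegral => //.
  - exact: bounded_mfunZ.
  - apply: bounded_mfunD; last exact: bounded_mfunZ.
    by apply: bounded_mfunZ; exact: bounded_mfunB.
  move=> P; have [PS _] := normal_grplane P.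
  have := wC _ _ uS PS; have := sphere2_dot_le1 uS PS; rewrite /normal_width.
  set d := dot _ _ => d1 h; set a := width K u in h *; set b := width K _ in h *.
  have dk0 : 0 <= d ^+ (2 * k) by rewrite exprM exprn_ge0// sqr_ge0.
  have dk1 : d ^+ (2 * k) <= 1.
    by apply: le_trans (ler_norm _) _; rewrite normrX exprn_ile1.
  have -> : d ^+ (2 * k.+1) = d ^+ (2 * k) * d ^+ 2 by rewrite mulnS exprD mulrC.
  have h1 : 0 <= d ^+ (2 * k) * (C * (1 - d ^+ 2) - (a - b) ^+ 2).
    by rewrite mulr_ge0// subr_ge0.
  have h2 : 0 <= (1 - d ^+ (2 * k)) * (b - W0) ^+ 2.
    by rewrite mulr_ge0 ?sqr_ge0// subr_ge0.
  have h3 : 0 <= d ^+ (2 * k) * (a - b - (b - W0)) ^+ 2 by rewrite mulr_ge0 ?sqr_ge0.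
  (* The last summand of the decomposition comes from 2 x^2 + 2 y^2 - (x + y)^2 = (x - y)^2 with x =
     a - b and y = b - W0. *)
  rewrite -subr_ge0; set t := d ^+ (2 * k) in h1 h2 h3 *.
  rewrite (_ : _ - _ = 2 * (t * (C * (1 - d ^+ 2) - (a - b) ^+ 2))
    + 2 * ((1 - t) * (b - W0) ^+ 2) + t * (a - b - (b - W0)) ^+ 2); last by ring.
  by rewrite !addr_ge0// mulr_ge0.
rewrite bounded_RintegralZ// bounded_RintegralD//; last 2 first.
- by apply: bounded_mfunZ; exact: bounded_mfunB.
- exact: bounded_mfunZ.
rewrite !bounded_RintegralZ//; last exact: bounded_mfunB.
rewrite bounded_RintegralB//.
rewrite -!/(zonal_moment nu _ u) !(zonal_momentE nu_inv nu_mass _ uS).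
rewrite (_ : (2 * k.+1 + 1)%N = (2 * k + 3)%N); last by lia.
rewrite inv_odd_sub; have := width_deviation0; set Z := \int[nu]_P _ => Z0 h.
have {h Z0} : (width K u - W0) ^+ 2 * (2 * pi / (2 * k + 1)%:R) <=
    4 * C / (2 * k + 3)%:R * (2 * pi / (2 * k + 1)%:R).
  apply: (le_trans h); rewrite -[leRHS]addr0; apply: lerD; last by lra.
  by rewrite le_eqVlt; apply/orP; left; apply/eqP; ring.
by rewrite ler_pM2r// divr_gt0// mulr_gt0 ?pi_gt0.
Qed.

End Converse.

Theorem proposition4p3 (R : realType)
    (nu : {finite_measure set (grplane R) -> \bar R})
    (nu_invariant : rotation_invariant nu)
    (nu_mass : nu [set: grplane R] = (2 * pi)%:E)
    (K : set 'rV[R]_3)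
    (K_nonempty : K !=set0)
    (K_compact : compact K)
    (K_convex : convex_set (K : set (convex_lmodType 'rV[R]_3)))
    (K_C2 : C2_on_sphere (support_function K)) :
  (constant_width K ->
     forall f : R -> R,
     (forall t : R, -1 <= t <= 1 -> f (- t) = f t) ->
     (exists M : R, forall t : R, -1 <= t <= 1 -> `|f t| <= M) ->
     measurable_fun (`[(-1)%R, 1%R] : set R) f ->
     mean_width_identity nu K f) /\
  ((forall n : nat, (1 <= n)%N ->
      mean_width_identity nu K (fun t => (legendre R (2 * n)).[t])) ->
   constant_width K).
Proof.
split=> [[W KW] f f_even f_bounded mf|hyp].
  by rewrite /mean_width_identity (mean_width_cst KW); exact: pair_integral_cst.
have mom := width_moment_legendre nu_mass K_nonempty K_compact K_convex hyp.
by eexists; exact: (width_eq_mean nu_invariant nu_mass K_nonempty K_compact mom).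
Qed.
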